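(* Let $\omega:[0,1]\to\mathbb{R}$ be a (nonconstant) continuous function, and let $\mathbb{T}$ be its associated tree. Then, with the notation of the context, $$\mathcal{V}(\omega)=\mathcal{H}(\mathbb{T})=\limsup_{a\to0}\frac{\log L^a}{\log(1/a)}+1=\Bigl(\limsup_{a\to0}\frac{\log N^a}{\log(1/a)}\Bigr)\vee1=\overline{\dim}\,\mathbb{T}.$$
   Context: For a continuous nonconstant $\omega:[0,1]\to\mathbb{R}$, put $\delta(s,t)=\omega(s)+\omega(t)-2\inf_{[s,t]}\omega$ ($[s,t]$ denotes the interval with endpoints $s,t$). This is a semi-distance on $[0,1]$; the quotient metric space $\mathbb{T}=([0,1]/\delta,\delta)$ is a compact real tree, i.e. any two points $\tau_1,\tau_2$ are joined by a unique arc $[\tau_1,\tau_2]$, which is isometric to $[0,\delta(\tau_1,\tau_2)]$. Let $\pi:[0,1]\to\mathbb{T}$ be the projection, and root $\mathbb{T}$ at $O=\pi(U)$, where $U$ is a time at which $\omega$ attains its minimum. A point $\tau_1$ is above $\tau_2$ if $\tau_2\in[O,\tau_1]$. A leaf is a point with no other point above it. The length measure $\lambda$ is the unique measure on $\mathbb{T}$ for which the set of leaves has measure zero and the measure of each arc is its length. For $\tau\in\mathbb{T}$, $h(\tau)=\sup\{\delta(\tau,\sigma):\sigma\in\mathbb{T},\ \sigma\text{ above }\tau\}$ is the height of the highest branch above $\tau$. For $a>0$, the trimmed tree is $\mathbb{T}^a=\{\tau\in\mathbb{T}:h(\tau)\ge a\}$ (a subtree containing $O$ when nonempty, with finitely many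 leaves); $N^a$ is the number of leaves of $\mathbb{T}^a$ and $L^a=\lambda(\mathbb{T}^a)$. For $p\ge1$, $V_p(\omega)=\sup\sum_i|\omega(t_{i+1})-\omega(t_i)|^p$ over subdivisions $(t_i)$ of $[0,1]$; $\mathcal{V}(\omega)=\inf\{p\ge1:V_p(\omega)<\infty\}$ (with $\inf\varnothing=\infty$). Also $$\mathcal{H}(\mathbb{T})=\inf\Bigl\{p\ge1:\int_{\mathbb{T}}h(\tau)^{p-1}\lambda(d\tau)<\infty\Bigr\},\qquad \overline{\dim}\,\mathbb{T}=\limsup_{a\downarrow0}\frac{\log\mathcal{N}(a)}{\log(1/a)},$$ where $\mathcal{N}(a)$ is the minimal number of balls of radius $a$ needed to cover $\mathbb{T}$ (upper box dimension). *)

(* Defs.v *)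
From HB Require Import structures.
From mathcomp Require Import all_boot all_order all_algebra generic_quotient.
From mathcomp Require Import all_classical all_reals all_analysis.
From mathcomp Require Import lra.

Set Implicit Arguments.
Unset Strict Implicit.
Unset Printing Implicit Defensive.

Import Order.TTheory GRing.Theory Num.Theory.
Import numFieldNormedType.Exports numFieldTopology.Exports.

Local Open Scope classical_set_scope.
Local Open Scope ring_scope.
Local Open Scope quotient_scope.

Notation unit_itv R := (set_type `[0%R, 1%R : R]%classic).

(* An Order.min/max pair gives the interval with endpoints s and t in either
   order *)
Definition path_inf (R : realType) (w : R -> R) (s t : R) : R :=
  inf (w @` `[Num.min s t, Num.max s t]).

Definition path_dist (R : realType) (w : R -> R) (s t : R) : R :=
  w s + w t - 2 * path_inf w s t.

Section semidistance.
Variables (R : realType) (w : R -> R).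
Hypothesis wc : {within `[0, 1], continuous w}.
Local Notation I := (unit_itv R).
Implicit Types s t u : I.

Let itvP s : 0 <= val s <= 1.
Proof. by have /set_mem := valP s; rewrite /= in_itv. Qed.

Lemma path_inf_le s t (x : R) :
  Num.min (val s) (val t) <= x <= Num.max (val s) (val t) ->
  path_inf w (val s) (val t) <= w x.
Proof.
move=> /andP[lx xu]; apply: ge_inf; last first.
  by exists x => //=; rewrite in_itv /= lx.
have [c _ cmin] := EVT_min (@ler01 R) wc.
exists (w c) => _ [y /= + <-]; rewrite in_itv /= => /andP[ly yu].
apply: cmin; rewrite in_itv /=.
have /andP[s0 s1] := itvP s; have /andP[t0 t1] := itvP t.
rewrite (le_trans _ ly) ?(le_trans yu) //; first by rewrite ge_max s1.
by rewrite le_min s0.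
Qed.

Lemma path_inf_glb s t (m : R) :
  (forall x, Num.min (val s) (val t) <= x <= Num.max (val s) (val t) ->
     m <= w x) -> m <= path_inf w (val s) (val t).
Proof.
move=> h; apply: lb_le_inf.
  exists (w (val s)); exists (val s) => //=.
  by rewrite in_itv /= ge_min lexx le_max lexx.
by move=> _ [x /= + <-]; rewrite in_itv /= => /h.
Qed.

Lemma path_dist_sym s t : path_dist w (val s) (val t) = path_dist w (val t) (val s).
Proof. by rewrite /path_dist /path_inf minC maxC [w _ + _]addrC. Qed.

Lemma path_dist_refl s : path_dist w (val s) (val s) = 0.
Proof.
rewrite /path_dist /path_inf minxx maxxx set_itv1 image_set1 inf1.
by rewrite mulr_natl mulr2n subrr.
Qed.

Lemma path_dist_ge0 s t : 0 <= path_dist w (val s) (val t).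
Proof.
rewrite /path_dist subr_ge0 mulr_natl mulr2n lerD // path_inf_le //.
  by rewrite ge_min lexx le_max lexx.
by rewrite ge_min lexx le_max lexx !orbT.
Qed.

Lemma path_dist_triangle t s u : path_dist w (val s) (val u) <=
  path_dist w (val s) (val t) + path_dist w (val t) (val u).
Proof.
pose m := Num.min (path_inf w (val s) (val t)) (path_inf w (val t) (val u)).
have st : path_inf w (val s) (val t) <= w (val t).
  by rewrite path_inf_le // ge_min lexx le_max lexx !orbT.
have tu : path_inf w (val t) (val u) <= w (val t).
  by rewrite path_inf_le // ge_min lexx le_max lexx.
have su : m <= path_inf w (val s) (val u).
  apply: path_inf_glb => x; rewrite ge_min le_max /m ge_min => xsu.
  have [xst|xst] := boolP ((Num.min (val s) (val t) <= x) &&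
                           (x <= Num.max (val s) (val t))).
    by rewrite path_inf_le.
  rewrite [X in _ || X]path_inf_le ?orbT //; move: xsu xst.
  rewrite !ge_min !le_max.
  by case: (leP x (val t)); case: (leP (val s) x); case: (leP x (val s));
    case: (leP (val u) x); case: (leP x (val u)); case: (leP (val t) x) => //=;
    rewrite ?orbT ?orbF ?andbT ?andbF // => *; lra.
have : path_inf w (val s) (val t) + path_inf w (val t) (val u) <= w (val t) + m.
  by rewrite /m minElt; case: ifP => _; lra.
rewrite /path_dist; lra.
Qed.

Definition path_equiv s t : bool := path_dist w (val s) (val t) == 0.

Lemma path_equiv_refl : reflexive path_equiv.
Proof. by move=> s; rewrite /path_equiv path_dist_refl. Qed.

Lemma path_equiv_sym : symmetric path_equiv.
Proof. by move=> s t; rewrite /path_equiv path_dist_sym. Qed.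

Lemma path_equiv_trans : transitive path_equiv.
Proof.
move=> t s u /eqP st /eqP tu; rewrite /path_equiv eq_le path_dist_ge0 andbT.
by rewrite (le_trans (path_dist_triangle t _ _)) // st tu addr0.
Qed.

Canonical path_equiv_equiv :=
  EquivRel path_equiv path_equiv_refl path_equiv_sym path_equiv_trans.

Definition tree : Type := {eq_quot path_equiv_equiv}.

HB.instance Definition _ := Choice.on tree.
HB.instance Definition _ := EqQuotient.on tree.

Definition tree_dist (x y : tree) : R :=
  path_dist w (val (repr x)) (val (repr y)).

Lemma tree_dist_pi s t :
  tree_dist (\pi_tree s) (\pi_tree t) = path_dist w (val s) (val t).
Proof.
have reprE u : path_dist w (val (repr (\pi_tree u))) (val u) = 0.
  by apply/eqP; rewrite -/(path_equiv _ _); apply/(@eqquotP _ _ tree); rewrite reprK.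
rewrite /tree_dist; apply/eqP; rewrite eq_le; apply/andP; split.
  apply: le_trans (path_dist_triangle s _ _) _; rewrite reprE add0r.
  apply: le_trans (path_dist_triangle t _ _) _.
  by rewrite (path_dist_sym t) reprE addr0.
apply: le_trans (path_dist_triangle (repr (\pi_tree s)) _ _) _.
rewrite (path_dist_sym s) reprE add0r.
apply: le_trans (path_dist_triangle (repr (\pi_tree t)) _ _) _.
by rewrite reprE addr0.
Qed.

Let tree_distxx x : tree_dist x x = 0.
Proof. exact: path_dist_refl. Qed.

Let tree_dist_positivity x y : tree_dist x y = 0 -> x = y.
Proof.
move=> /eqP xy; rewrite -[x]reprK -[y]reprK.
exact/(@eqquotP _ _ tree).
Qed.

Let tree_dist_sym x y : tree_dist x y = tree_dist y x.
Proof. exact: path_dist_sym. Qed.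

Let tree_dist_triangle y x z : tree_dist x z <= tree_dist x y + tree_dist y z.
Proof. exact: path_dist_triangle. Qed.

HB.instance Definition _ := @isMetric.Build R tree tree_dist
  tree_distxx tree_dist_positivity tree_dist_sym tree_dist_triangle.

Let unit_itv0 : (0 : R) \in `[0%R, 1%R]%classic.
Proof. by rewrite inE /= in_itv /= lexx ler01. Qed.

(* Pointedness is required by g_sigma_algebraType *)
HB.instance Definition _ := isPointed.Build tree (\pi_tree (SigSub unit_itv0)).

End semidistance.

Notation tree_borel wc := (g_sigma_algebraType (@open (tree wc))).

Section tree_notions.
Variables (R : realType) (w : R -> R).
Variable wc : {within `[0, 1], continuous w}.
Local Notation T := (tree wc).
Implicit Types (x y z : T) (p a : R).

(* Values of g outside `[0, mdist x y] are irrelevant *)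
Definition geodesic x y (g : R -> T) : Prop :=
  [/\ g 0 = x, g (mdist x y) = y &
      {in `[0, mdist x y]%R &, forall s t, mdist (g s) (g t) = `|s - t|}].

(* In a real tree all geodesics from x to y have the same image, so that this
   union is the unique arc joining x to y *)
Definition arc x y : set T :=
  [set z | exists2 g, geodesic x y g & (g @` `[0, mdist x y]) z].

Variable O : T.

Definition above x y : Prop := arc O x y.

Definition leaves (A : set T) : set T :=
  [set x | A x /\ forall y, A y -> above y x -> y = x].

Definition is_length_measure (lambda : {measure set (tree_borel wc) -> \bar R})
    : Prop :=
  lambda (leaves setT) = 0%E /\ forall x y, lambda (arc x y) = (mdist x y)%:E.

Definition height x : R := sup [set mdist x y | y in [set y | above y x]].

Definition trimmed_tree a : set T := [set x | a <= height x].

Definition trimmed_leaf_number a : \bar R := counting (leaves (trimmed_tree a)).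

Definition covering_number a : \bar R :=
  ereal_inf [set counting A | A in [set A : set T |
    \bigcup_(x in A) ball x a = setT]].

Definition height_index (lambda : {measure set (tree_borel wc) -> \bar R})
    : \bar R :=
  ereal_inf [set p%:E | p in [set p | 1 <= p /\
    (\int[lambda]_x ((height x) `^ (p - 1))%:E < +oo)%E]].

End tree_notions.

(* limsup of log (f a) / log (1 / a) as a decreases to 0 *)
Definition growth_exponent (R : realType) (f : R -> \bar R) : \bar R :=
  limf_esup (fun a : R => lne (f a) * ((ln a^-1)^-1)%:E)%E 0^'+.

Definition upper_box_dim (R : realType) (w : R -> R)
    (wc : {within `[0, 1], continuous w}) : \bar R :=
  growth_exponent (@covering_number R w wc).

Definition p_variation (R : realType) (p : R) (w : R -> R) : \bar R :=
  ereal_sup [set (\sum_(0 <= i < size s)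
      `|w (nth 1 (0 :: s) i.+1) - w (nth 1 (0 :: s) i)| `^ p)%:E
    | s in itv_partition 0 1].

Definition variation_index (R : realType) (w : R -> R) : \bar R :=
  ereal_inf [set p%:E | p in [set p : R | 1 <= p /\
    (p_variation p w < +oo)%E]].

(* Main.v *)
(* Root the tree at a minimum of w; then w defines a level function on T, and z
   lies on the arc [O, x] iff delta(z, x) = level x - level z.  The exponents
   are compared in a cycle.
   - Cutting T^a \ T^b into arcs ending at the leaves of T^a gives
     L^a <= L^b + (b - a) N^a; with b = 2 a this bounds the exponent of L by
     that of N minus one when the latter exceeds one.
   - Points at distance a above distinct leaves of T^a are 2 a apart, so N^a is
     at most the covering number, which is itself at least of order 1 / a.
   - Between consecutive times of an a-separated family w oscillates by at least
     a / 3, so that the covering number is O(a^-p) when V_p is finite.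
   - Disjoint upward (or downward) oscillations of w of size 2 a contain, after
     cutting at multiples of a, disjoint segments of length a / 2 of T^(a/2):
     there are at most 2 L^(a/2) / a of them, and a sum over dyadic scales
     bounds V_p.
   Finally H is compared with the exponent of L by the Markov inequality in one
   direction and by a dyadic decomposition of the integral in the other. *)

Require Import Defs.
From HB Require Import structures.
From mathcomp Require Import finmap.
From mathcomp Require Import all_boot all_order all_algebra generic_quotient.
From mathcomp Require Import all_classical all_reals all_analysis.
From mathcomp Require Import measurable_realfun.
From mathcomp Require Import lra.

Set Implicit Arguments.
Unset Strict Implicit.
Unset Printing Implicit Defensive.

Import Order.TTheory GRing.Theory Num.Theory.
Import numFieldNormedType.Exports numFieldTopology.Exports.

Local Open Scope classical_set_scope.
Local Open Scope ring_scope.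
Local Open Scope quotient_scope.

(** * Betweenness of times and last crossings of a level *)

Definition between (R : realType) (s t u : R) : bool :=
  Num.min s t <= u <= Num.max s t.

(** Lower bounds for [w] from each endpoint to a common time [t] combine through this into a bound
    between the two endpoints. *)
Lemma between_split (R : realType) (t s s' u : R) :
  between s s' u -> between s t u \/ between t s' u.
Proof.
rewrite /between !ge_min !le_max.
case: (leP u t); case: (leP s u); case: (leP u s); case: (leP s' u);
  case: (leP u s'); case: (leP t u) => //=;
  rewrite ?orbT ?orbF ?andbT ?andbF /=; try tauto.
all: move=> *; lra.
Qed.

Lemma betweenC (R : realType) (s t u : R) : between s t u = between t s u.
Proof. by rewrite /between minC maxC. Qed.

Lemma between_l (R : realType) (s t : R) : between s t s.
Proof. by rewrite /between ge_min lexx le_max lexx. Qed.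

Lemma between_r (R : realType) (s t : R) : between s t t.
Proof. by rewrite betweenC between_l. Qed.

Lemma between_sub (R : realType) (s t m u : R) :
  between s t m -> between s m u -> between s t u.
Proof.
rewrite /between => /andP[m1 m2] /andP[u1 u2]; apply/andP; split.
  by apply: le_trans u1; rewrite le_min m1 ge_min lexx.
by apply: (le_trans u2); rewrite ge_max m2 le_max lexx.
Qed.

Section last_crossing.
Variables (R : realType) (v : R -> R).
Hypothesis vc : continuous v.

(** Take for [s] the largest solution of [v s = r], which exists by compactness: a later value less
    than [r] would, by the intermediate value theorem, be followed by a later solution. *)
Lemma last_crossing (a b r : R) : a <= b -> v a <= r <= v b ->
  exists s, [/\ a <= s <= b, v s = r & forall u, s <= u <= b -> r <= v u].
Proof.
move=> ab /andP[ar rb].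
have ivt c : a <= c <= b -> v c <= r ->
    exists2 u, c <= u <= b & v u = r.
  move=> /andP[ac cb] cr.
  have [] := @IVT R v c b r cb.
  - exact: continuous_subspaceT.
  - by rewrite ge_min cr le_max rb orbT.
  - by move=> u; rewrite in_itv /= => ? ?; exists u.
have [|||s] := @compact_EVT_max _ R id (`[a, b]%classic `&` [set u | v u = r]).
- have [|u] := ivt a _ ar; first by rewrite lexx.
  by move=> ? ?; exists u; split => //=; rewrite in_itv.
- apply: compact_closedI; first exact: segment_compact.
  apply: (@preimage_closed _ _ v [set r]); last exact: closed_eq.
  by move=> ? _; exact: vc.
- by apply: continuous_subspaceT => ?; exact: cvg_id.
- rewrite inE /= in_itv /= => -[asb vs] smax; exists s;
  split => // u /andP[su ub].
  rewrite leNgt; apply/negP => ur.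
  have [|u' /andP[uu' u'b] vu'] := ivt u _ (ltW ur).
    by rewrite ub (le_trans _ su)//; case/andP: asb.
  have : u' <= s.
    apply: smax; rewrite inE /= in_itv /= u'b vu' (le_trans _ uu')//.
    by rewrite (le_trans _ su)//; case/andP: asb.
  move=> u's; have us : u = s by apply/eqP; rewrite eq_le su (le_trans uu').
  by move: ur; rewrite us vs ltxx.
Qed.

End last_crossing.

Lemma last_crossing_between (R : realType) (v : R -> R) (a b r : R) :
  continuous v -> v a <= r <= v b ->
  exists s, [/\ between a b s, v s = r & forall u, between s b u -> r <= v u].
Proof.
move=> vc arb; have [ab|/ltW ba] := leP a b.
  have [s [asb vs h]] := @last_crossing R v vc a b r ab arb.
  exists s; split => //; first by rewrite /between (min_idPl ab) (max_idPr ab).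
  by case/andP: asb => _ sb; move=> u; rewrite /between (min_idPl sb) (max_idPr
    sb); exact: h.
(* When [b <= a], reversing time reduces to the previous case. *)
have vNc : continuous (v \o -%R).
  by move=> x; apply: continuous_comp; [exact: continuousN|exact: vc].
have [||s [/andP[as_ sb] vs h]] := @last_crossing R _ vNc (- a) (- b) r.
- by rewrite lerN2.
- by rewrite /= !opprK.
exists (- s); split => //.
  by rewrite /between (min_idPr ba) (max_idPl ba); apply/andP; split; lra.
have sb' : b <= - s by lra.
move=> u; rewrite /between (min_idPr sb') (max_idPl sb') => /andP[bu us].
by rewrite -[u]opprK; apply: (h (- u)); apply/andP; split; lra.
Qed.

(** * Extension of the time parameter to the whole line *)

Section tree_geometry.
Variables (R : realType) (w : R -> R).
Hypothesis wc : {within `[0, 1], continuous w}.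
Local Notation T := (tree wc).
Local Notation I := (unit_itv R).
Implicit Types (s t : I) (x y z : T).

Lemma unit_itvP s : 0 <= val s <= 1.
Proof. by have /set_mem := valP s; rewrite /= in_itv. Qed.

Lemma unit_itv_clampP (u : R) : Num.max 0 (Num.min 1 u) \in `[0, 1]%classic.
Proof.
rewrite inE /= in_itv /= le_max lexx /= ge_max ler01 /=.
by rewrite ge_min lexx.
Qed.

(** A retraction of the line onto the unit interval: composed with it, [w] becomes continuous on all
    of [R]. *)
Definition clamp (u : R) : I := SigSub (unit_itv_clampP u).

Lemma clampK (u : R) : 0 <= u <= 1 -> val (clamp u) = u.
Proof. by move=> /andP[u0 u1] /=; rewrite (min_idPr u1) (max_idPr u0). Qed.

Lemma val_clamp s : clamp (val s) = s.
Proof. by apply/val_inj; rewrite clampK// unit_itvP. Qed.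

Lemma between_unit_itv s t (u : R) : between (val s) (val t) u -> 0 <= u <= 1.
Proof.
have /andP[s0 s1] := unit_itvP s; have /andP[t0 t1] := unit_itvP t.
move=> /andP[lu uu]; rewrite (le_trans _ lu) ?le_min ?s0//=.
by rewrite (le_trans uu)// ge_max s1.
Qed.

Lemma val_clamp_continuous : continuous (val \o clamp : R -> R).
Proof.
have -> : val \o clamp = (fun u : R => Num.max 0 (Num.min 1 u)) by apply/funext.
move=> u; apply: continuous_max; first exact: cvg_cst.
by apply: continuous_min; [exact: cvg_cst|exact: cvg_id].
Qed.

Lemma w_clamp_continuous : continuous (w \o (val \o clamp)).
Proof.
move=> u.
have /subspace_continuousP wc' := wc.
have := wc' (val (clamp u)); rewrite /= in_itv /= => /(_ (unit_itvP (clamp u))).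
apply: cvg_trans => A /=; rewrite /within /= => wA.
have := @val_clamp_continuous u _ wA.
apply: (@filterS R (nbhs u)) => t /= h.
by apply: h; rewrite in_itv /=; exact: (unit_itvP (clamp t)).
Qed.

End tree_geometry.

(** * The level function and the order of the rooted tree *)

Section tree_order.
Variables (R : realType) (w : R -> R).
Hypothesis wc : {within `[0, 1], continuous w}.
Local Notation T := (tree wc).
Local Notation I := (unit_itv R).
Implicit Types (s t : I) (x y z : T).

Definition level x : R := w (val (repr x)).

(* By [arcP] below, this says that z lies on the arc from the root to x, for any
   root at which w is minimal. *)
Definition below z x : Prop := mdist z x = level x - level z.

Lemma mdist_pi s t : mdist (\pi_T s) (\pi_T t) = path_dist w (val s) (val t).
Proof. exact: tree_dist_pi. Qed.

Lemma level_dist_path s t :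
  `|w (val s) - w (val t)| <= path_dist w (val s) (val t).
Proof.
have := path_inf_le wc (between_l (val s) (val t)).
have := path_inf_le wc (between_r (val s) (val t)).
rewrite /path_dist ler_norml => ? ?; apply/andP; split; lra.
Qed.

(** The time chosen by [repr] is at distance zero from [s], and the distance bounds the difference
    of the values of [w]. *)
Lemma level_pi s : level (\pi_T s) = w (val s).
Proof.
have := level_dist_path (repr (\pi_T s)) s.
by rewrite -mdist_pi reprK mdistxx normr_le0 subr_eq0 => /eqP.
Qed.

Lemma level_dist x y : `|level x - level y| <= mdist x y.
Proof. by rewrite -[x]reprK -[y]reprK !level_pi mdist_pi level_dist_path. Qed.

Lemma belowP s t : below (\pi_T s) (\pi_T t) <->
  forall u, between (val s) (val t) u -> w (val s) <= w u.
Proof.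
rewrite /below !level_pi mdist_pi /path_dist; split => [e u stu|h].
  have := path_inf_le wc stu; lra.
have := path_inf_glb h.
have := path_inf_le wc (between_l (val s) (val t)); lra.
Qed.

Lemma tree_ind (P : T -> Prop) : (forall s, P (\pi_T s)) -> forall x, P x.
Proof. by move=> h x; rewrite -[x]reprK. Qed.

Lemma below_level z x : below z x -> level z <= level x.
Proof. by rewrite /below => /esym e; rewrite -subr_ge0 e mdist_ge0. Qed.

Lemma below_refl x : below x x.
Proof. by rewrite /below mdistxx subrr. Qed.

Lemma below_trans y x z : below x y -> below y z -> below x z.
Proof.
rewrite /below => xy yz; apply/eqP; rewrite eq_le; apply/andP; split.
  have := metric_triangle x y z; lra.
have := level_dist x z; rewrite ler_norml; lra.
Qed.

(** The interval between times [s] and [s'] of [z] and [z'] splits at a time [t] of [x]. On each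
    piece [w] is at least its value at [s] or at [s'], so the infimum is the smaller of these. Hence
    the points below [x] form a chain. *)
Lemma below_dist x z z' : below z x -> below z' x ->
  mdist z z' = `|level z - level z'|.
Proof.
elim/tree_ind: x => t; elim/tree_ind: z => s; elim/tree_ind: z' => s'.
move=> /belowP zt /belowP z't; apply/eqP; rewrite eq_le level_dist andbT.
rewrite !level_pi mdist_pi /path_dist.
have /path_inf_glb : forall u, between (val s) (val s') u ->
    Num.min (w (val s)) (w (val s')) <= w u.
  move=> u /(between_split (val t))[/zt|].
    by apply: le_trans; rewrite ge_min lexx.
  by rewrite betweenC => /z't; apply: le_trans; rewrite ge_min lexx orbT.
by case: (leP (w (val s)) (w (val s'))) => ? ?;
  [rewrite ler0_norm|rewrite gtr0_norm]; lra.
Qed.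

Lemma below_comparable x z z' : below z x -> below z' x ->
  level z <= level z' -> below z z'.
Proof.
move=> zx z'x zz'; rewrite /below (below_dist zx z'x) distrC ger0_norm//.
by rewrite subr_ge0.
Qed.

Lemma below_eq x z z' : below z x -> below z' x -> level z = level z' -> z = z'.
Proof.
move=> zx z'x e; apply: mdist_positivity.
by rewrite (below_dist zx z'x) e subrr normr0.
Qed.

Lemma below_anti x y : below x y -> level x = level y -> x = y.
Proof. by move=> xy; apply: (below_eq xy (below_refl y)). Qed.

(** The branching point [m] is the class of a time at which [w] is minimal between times of [x] and
    [y]. *)
Lemma meet_exists x y : exists m,
  [/\ below m x, below m y & mdist x y = level x + level y - 2 * level m].
Proof.
elim/tree_ind: x => s; elim/tree_ind: y => t.
have st : Num.min (val s) (val t) <= Num.max (val s) (val t).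
  by rewrite ge_min le_max lexx.
have wst : {within `[Num.min (val s) (val t), Num.max (val s) (val t)],
    continuous w}.
  apply: continuous_subspaceW wc => u /=; rewrite !in_itv /=.
  exact: between_unit_itv.
have [u] := EVT_min st wst.
rewrite in_itv => stu umin.
have vu : val (clamp u) = u by rewrite clampK// (between_unit_itv stu).
have hmin u' : between (val s) (val t) u' -> w u <= w u'.
  by move=> ?; apply: umin; rewrite in_itv.
exists (\pi_T (clamp u)); split.
- apply/belowP => u'; rewrite vu betweenC => h.
  by apply: hmin; apply: between_sub h.
- apply/belowP => u'; rewrite vu betweenC => h.
  by apply: hmin; rewrite betweenC; apply: between_sub h; rewrite betweenC.
- rewrite !level_pi mdist_pi vu /path_dist.
  have := path_inf_glb hmin; have := path_inf_le wc stu; lra.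
Qed.

Variable U : I.
Hypothesis w_min : forall t, w (val U) <= w (val t).
Local Notation O := (\pi_T U).

Lemma level_root x : level O <= level x.
Proof. by elim/tree_ind: x => t; rewrite !level_pi. Qed.

Lemma below_root x : below O x.
Proof.
elim/tree_ind: x => t; apply/belowP => u /between_unit_itv u01.
by rewrite -(clampK u01).
Qed.

(** On the way from [U] to a time [t] of [x], take the last time at which [w] equals [r]: from there
    to [t], [w] stays at or above [r]. *)
Lemma below_exists x (r : R) : level O <= r <= level x ->
  exists z, below z x /\ level z = r.
Proof.
elim/tree_ind: x => t; rewrite !level_pi => r_itv.
have [] := @last_crossing_between _ _ (val U) (val t) r (w_clamp_continuous wc).
  by rewrite /comp !val_clamp.
move=> s [Us ws hs]; exists (\pi_T (clamp s)).
have s01 := between_unit_itv Us.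
split; last by rewrite level_pi.
apply/belowP => u; rewrite clampK// => su.
have u01 : 0 <= u <= 1.
  have : between (val (clamp s)) (val t) u by rewrite clampK.
  exact: between_unit_itv.
by have := hs _ su; rewrite -ws /comp !clampK.
Qed.

Lemma arcP x z : Defs.arc O x z <-> below z x.
Proof.
have dO y : mdist O y = level y - level O by exact: below_root.
split=> [[g [g0 g1 gd] [r /= rd <-]]|zx].
  have /andP[r0 r1] : 0 <= r <= mdist O x by move: rd; rewrite in_itv.
  (* Comparing [g r] with both ends of the geodesic gives its distances to [O] and to [x]; the first
     one fixes its level, and the second one is then the difference of levels. *)
  have := gd 0 r; rewrite !in_itv /= lexx mdist_ge0 r0 r1 => /(_ isT isT).
  have := gd r (mdist O x); rewrite !in_itv /= lexx mdist_ge0 r0 r1 => /(_ isT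
    isT).
  rewrite g0 g1 !dO sub0r normrN (ger0_norm r0) distrC ger0_norm; last first.
    by rewrite subr_ge0 -dO.
  rewrite /below => -> ?; lra.
have : forall r, exists z, 0 <= r <= mdist O x ->
    below z x /\ level z = level O + r.
  move=> r; have [/andP[r0 r1]|_] := boolP (0 <= r <= mdist O x);
    last by exists x.
  have [|y hy] := @below_exists x (level O + r); last by exists y.
  by rewrite dO in r1; apply/andP; split; lra.
move=> /choice[g hg].
exists g; last first.
  exists (level z - level O); last first.
    have [|gx glev] := hg (level z - level O).
      by rewrite subr_ge0 level_root dO lerD2r below_level.
    by apply: below_eq gx zx _; rewrite glev; lra.
  by rewrite /= in_itv /= subr_ge0 level_root dO lerD2r below_level.
split.
- have [|gx glev] := hg 0; first by rewrite lexx mdist_ge0.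
  by apply: below_eq gx (below_root x) _; rewrite glev addr0.
- have [|gx glev] := hg (mdist O x); first by rewrite lexx mdist_ge0.
  by apply: below_eq gx (below_refl x) _; rewrite glev dO; lra.
- move=> r r'; rewrite !in_itv => /= /hg[rx rlev] /hg[r'x r'lev].
  by rewrite (below_dist rx r'x) rlev r'lev; congr `|_|; lra.
Qed.

End tree_order.

(** * Topology of the tree and measurability of the height *)

Section tree_topology.
Variables (R : realType) (w : R -> R).
Hypothesis wc : {within `[0, 1], continuous w}.
Local Notation T := (tree wc).
Local Notation I := (unit_itv R).
Implicit Types (s t : I) (x y z : T).

Lemma lipschitz_continuous (f : T -> R) (C : R) : 0 < C ->
  (forall x y, `|f x - f y| <= C * mdist x y) -> continuous f.
Proof.
move=> C0 fC x.
apply/(@cvgrPdist_lt _ _ _ (nbhs x) (nbhs_filter x)) => e e0.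
apply/metricType_numDomainType.nbhs_mdistP.
exists (e / C) => /=; first by rewrite divr_gt0.
by move=> y /=; rewrite ltr_pdivlMr// mulrC; apply: le_lt_trans.
Qed.

Lemma level_continuous : continuous (@level _ _ wc).
Proof.
by apply: (@lipschitz_continuous _ 1) => // x y; rewrite mul1r level_dist.
Qed.

Lemma mdist_continuous x : continuous (mdist x).
Proof.
apply: (@lipschitz_continuous _ 1) => // y z; rewrite mul1r ler_norml.
have := metric_triangle x y z; have := metric_triangle x z y.
rewrite (metric_sym z y) => ? ?; apply/andP; split; lra.
Qed.

(** This defect vanishes exactly when [x] is below [y]; its continuity in each variable makes the
    sets of points above, or below, a given point closed. *)
Definition above_gap x y : R := mdist x y - (level y - level x).

Lemma above_gap_continuous x : continuous (above_gap x).
Proof.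
apply: (@lipschitz_continuous _ 2) => // y z; rewrite /above_gap.
have := level_dist y z; have := metric_triangle x y z.
have := metric_triangle x z y; rewrite (metric_sym z y) !ler_norml.
move=> ? ? /andP[? ?]; apply/andP; split; lra.
Qed.

Lemma below_gap_continuous x : continuous (above_gap ^~ x).
Proof.
apply: (@lipschitz_continuous _ 2) => // y z; rewrite /above_gap.
have := level_dist y z; have := metric_triangle y z x.
have := metric_triangle z y x; rewrite (metric_sym z y) !ler_norml.
move=> ? ? /andP[? ?]; apply/andP; split; lra.
Qed.

Lemma closed_above x : closed [set y | below x y].
Proof.
rewrite (_ : [set y | below x y] = above_gap x @^-1` [set 0]); last first.
  apply/seteqP; split=> y; rewrite /below /above_gap /= => h; last lra.
  by rewrite h subrr.
apply: preimage_closed; last exact: closed_eq.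
by move=> y _; exact: above_gap_continuous.
Qed.

Lemma closed_below x : closed [set y | below y x].
Proof.
rewrite (_ : [set y | below y x] = above_gap ^~ x @^-1` [set 0]); last first.
  apply/seteqP; split=> y; rewrite /below /above_gap /= => h; last lra.
  by rewrite h subrr.
apply: preimage_closed; last exact: closed_eq.
by move=> y _; exact: below_gap_continuous.
Qed.

Definition contour (u : R) : T := \pi_T (clamp u).

Lemma path_dist_small s (e : R) : 0 < e -> exists2 d : R, 0 < d &
  forall t, `|val s - val t| < d -> path_dist w (val s) (val t) < e.
Proof.
(* The distance is the increment of [w] from [s] to [t] plus twice the drop from [w (val s)] to the
   infimum, so oscillations below [e / 4] keep it below [e]. *)
move=> e0; have e4 : 0 < e / 4 by rewrite divr_gt0.
have [v [vc vE]] : exists v : R -> R,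
    continuous v /\ forall r, 0 <= r <= 1 -> v r = w r.
  exists (w \o (val \o @clamp R)); split; first exact: w_clamp_continuous.
  by move=> r r01; rewrite /comp clampK.
have /cvgrPdist_lt/(_ _ e4) := vc (val s).
move=> /nbhs_ballP[d /= d0 hd]; exists d => // t st.
have near_s (r : R) : between (val s) (val t) r -> `|w (val s) - w r| < e / 4.
  move=> hr; have r01 := between_unit_itv hr.
  have := hd r; rewrite !vE// ?unit_itvP//; apply.
  move: st hr; rewrite /ball /= /between ge_min le_max !ltr_norml.
  move=> /andP[? ?] /andP[h1 h2].
  by case/orP: h1 => ?; case/orP: h2 => ?; apply/andP; split; lra.
rewrite /path_dist.
have : w (val s) - e / 4 <= path_inf w (val s) (val t).
  by apply: path_inf_glb => r /near_s; rewrite ltr_norml; lra.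
have := near_s _ (between_r _ _); rewrite ltr_norml; lra.
Qed.

Lemma contour_continuous : continuous contour.
Proof.
move=> u; apply/metricType_numDomainType.cvgrPdist_lt => e e0.
have [d d0 hd] := path_dist_small (clamp u) e0.
have /cvgrPdist_lt/(_ _ d0) := @val_clamp_continuous R u.
by apply: (@filterS R (nbhs u)) => u' /hd; rewrite -(mdist_pi wc).
Qed.

Lemma tree_compact : compact [set: T].
Proof.
have -> : [set: T] = contour @` `[0, 1]%classic.
  apply/seteqP; split => // x _; exists (val (repr x)).
    by rewrite /= in_itv /= unit_itvP.
  by rewrite /contour val_clamp reprK.
apply: continuous_compact; last exact: segment_compact.
by apply: continuous_subspaceT; exact: contour_continuous.
Qed.

(** By compactness the supremum defining [height] is attained. *)
Lemma highest_above x : exists y, below x y /\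
  forall y', below x y' -> level y' <= level y.
Proof.
have [|||y] := @compact_EVT_max _ _ (@level _ _ wc) [set y | below x y].
- by exists x; exact: below_refl.
- by apply: subclosed_compact tree_compact _ => //; exact: closed_above.
- by apply: continuous_subspaceT; exact: level_continuous.
rewrite inE => xy ymax; exists y; split => // y' xy'.
by apply: ymax; rewrite inE.
Qed.

Lemma open_measurable_tree (A : set T) : open A ->
  measurable (A : set (tree_borel wc)).
Proof. by move=> oA; apply: sub_sigma_algebra. Qed.

Lemma closed_measurable_tree (A : set T) :
  closed A -> measurable (A : set (tree_borel wc)).
Proof.
move=> cA; rewrite -[A]setCK; apply: measurableC.
by apply: open_measurable_tree; apply: closed_openC.
Qed.

Section root.
Variable U : I.
Hypothesis w_min : forall t, w (val U) <= w (val t).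
Local Notation O := (\pi_T U).
Local Notation height := (height O).

Lemma height_ge x y : below x y -> level y - level x <= height x.
Proof.
move=> xy; apply: ub_le_sup; last by exists y => //=; apply/(arcP w_min).
have [y0 [_ hy0]] := highest_above x.
exists (level y0 - level x) => _ [z /= /(arcP w_min) xz <-].
by rewrite xz lerD2r; exact: hy0.
Qed.

Lemma height_attained x : exists2 y, below x y & height x = level y - level x.
Proof.
have [y [xy ymax]] := highest_above x; exists y => //.
apply/eqP; rewrite eq_le height_ge// andbT; apply: ge_sup.
  by exists (mdist x y), y => //; apply/(arcP w_min).
by move=> _ [z /= /(arcP w_min) xz <-]; rewrite xz lerD2r; exact: ymax.
Qed.

Lemma height_ge0 x : 0 <= height x.
Proof. by have := height_ge (below_refl x); rewrite subrr. Qed.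

Lemma height_le x y : below x y -> level y - level x + height y <= height x.
Proof.
move=> xy; have [z yz ->] := height_attained y.
by have := height_ge (below_trans xy yz); lra.
Qed.

(** Writes the set as a countable union of measurable ones: classes of rational times are dense, and
    such a class close enough to the highest point above [x] is itself above [x]. *)
Lemma height_gtE (b : R) : 0 <= b ->
  [set x | b < height x] =
  \bigcup_(q : rat) ([set x | below x (contour (ratr q))] `&`
     [set x | level x < level (contour (ratr q)) - b]).
Proof.
move=> b0; apply/seteqP; split => x /=; last first.
  by move=> [q _ [/= xq bq]]; have := height_ge xq; lra.
have [y xy ->] := height_attained x => bxy.
pose e := level y - level x - b.
have e0 : 0 < e by rewrite /e; lra.
pose A := [set u : R | mdist y (contour u) < e].
have oA : open A.
  apply: (@open_comp _ _ (mdist y \o contour) [set r : R | r < e]).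
    move=> u _; apply: continuous_comp; first exact: contour_continuous.
    exact: mdist_continuous.
  exact: open_lt.
have [|//|_ [/[swap] [[q _ <-]]]] := @dense_rat R A.
  exists (val (repr y)).
  by rewrite /A /= /contour val_clamp reprK mdistxx.
rewrite /A /= => yq; exists q => //=.
have := level_dist y (contour (ratr q)); rewrite ler_norml => /andP[l1 l2].
have lq : level x < level (contour (ratr q)) - b by rewrite /e in yq; lra.
split => //.
(* The level of the meet is at least [level y] minus the distance, hence exceeds [level x]; as both
   are below [y], the point [x] is below the meet. *)
have [m [my mq hm]] := meet_exists y (contour (ratr q)).
apply: below_trans mq; apply: below_comparable xy my _.
by rewrite /e in yq; lra.
Qed.

Lemma height_measurable : measurable_fun [set: tree_borel wc] height.
Proof.
move=> mT; apply: (measurability _ (RGenOInfty.measurableE R)) => //.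
move=> /= _ [_ [b ->] <-]; rewrite setTI.
have [b0|b0] := leP 0 b; last first.
  rewrite (_ : _ @^-1` _ = setT)//; apply/seteqP; split => // x _ /=.
  by rewrite in_itv /= andbT (lt_le_trans b0)// height_ge0.
rewrite (_ : _ @^-1` _ = [set x | b < height x]); last first.
  by apply/seteqP; split => x /=; rewrite in_itv /= andbT.
rewrite height_gtE//; apply: bigcupT_measurable_rat => q.
apply: measurableI; first by apply: closed_measurable_tree; exact: closed_below.
apply: open_measurable_tree.
apply: (@open_comp _ _ (@level _ _ wc) [set r : R | r < level (contour (ratr
  q)) - b]).
  by move=> ? _; exact: level_continuous.
exact: open_lt.
Qed.

Lemma trimmed_tree_measurable (a : R) :
  measurable (trimmed_tree O a : set (tree_borel wc)).
Proof.
rewrite (_ : trimmed_tree O a = [set: tree_borel wc] `&` height @^-1` `[a,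
  +oo[%classic).
  by apply: height_measurable => //; exact: measurable_itv.
by rewrite setTI; apply/seteqP; split => x; rewrite /= in_itv /= andbT.
Qed.

End root.
End tree_topology.

(** * Packings, leaves and the length measure *)

Lemma card_le_counting (R : realType) (S T : choiceType)
    (A : set S) (B : set T) :
  (A #<= B)%card -> (counting A <= counting B :> \bar R)%E.
Proof.
move=> AB; rewrite /counting; case: (asboolP (finite_set B)) => [fB|_];
  last exact: leey.
have fA : finite_set A := card_le_finite AB fB.
rewrite asboolT// lee_fin ler_nat; apply: leq_card_fset_set => //.
have /finite_setP[n An] := fA.
by rewrite (card_fset_set An) -(card_le_eql An).
Qed.

Lemma sume_le_const (R : realType) (J : Type) (s : seq J) (f : J ->
  \bar R) (c : R) :
  (forall i, f i <= c%:E)%E ->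
  (\sum_(i <- s) f i <= c%:E * (size s)%:R%:E)%E.
Proof.
move=> fc; elim: s => [|i s ih]; first by rewrite big_nil mule0.
by rewrite big_cons /= -natr1 EFinD muleDr// mule1 addeC leeD.
Qed.

Section tree_measure.
Variables (R : realType) (w : R -> R).
Hypothesis wc : {within `[0, 1], continuous w}.
Local Notation T := (tree wc).
Local Notation I := (unit_itv R).
Implicit Types (s t : I) (x y z : T).

(** An open ball of radius [a] contains at most one of the points, so choosing a centre for each of
    them is injective. *)
Lemma packing_le_covering (J : choiceType) (D : set J) (f : J -> T) (a : R) :
  (forall i j, D i -> D j -> i <> j -> 2 * a <= mdist (f i) (f j)) ->
  (counting D <= covering_number wc a)%E.
Proof.
move=> fsep; apply: le_ereal_inf_tmp => _ [A /= coverA <-].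
have : forall i, exists x, A x /\ ball x a (f i).
  move=> i; have : [set: T] (f i) by [].
  by rewrite -coverA => -[x Ax xfi]; exists x.
move=> /choice[c hc]; apply: card_le_counting.
have cinj : {in D &, injective c}.
  move=> i j; rewrite !inE => Di Dj cij; apply: contrapT => ij.
  have := fsep _ _ Di Dj ij.
  have [_] := hc i; have [_] := hc j; rewrite cij ballEmdist /= => h1 h2.
  have := metric_triangle (f i) (c j) (f j); rewrite (metric_sym (f i) (c j));
    lra.
rewrite -(card_le_eql (inj_card_eq cinj)); apply: subset_card_le.
by move=> _ [i _ <-]; have [] := hc i.
Qed.

Variable U : I.
Hypothesis w_min : forall t, w (val U) <= w (val t).
Local Notation O := (\pi_T U).
Local Notation height := (height O).
Local Notation leaves a := (leaves O (trimmed_tree O a)).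

(** Go down by [a] from the highest point [y] above [x]. By [height_le], any point strictly above
    the result has height less than [a], so the result is a leaf. *)
Lemma leaf_above x (a : R) : 0 <= a -> a <= height x ->
  exists z, [/\ leaves a z, below x z & level z - level x = height x - a].
Proof.
move=> a0 ah; have [y xy hx] := height_attained w_min x.
have [|z [zy lz]] := @below_exists _ _ wc U y (level y - a).
  by have := level_root w_min x; lra.
have xz : below x z by apply: below_comparable xy zy _; lra.
exists z; split => //; last by lra.
split; first by have := height_ge w_min zy; rewrite /trimmed_tree /=; lra.
move=> z' z'a /(arcP w_min) zz'; apply/esym/below_anti => //.
have := below_level zz'; have := height_le w_min (below_trans xz zz').
rewrite /trimmed_tree /= in z'a; lra.
Qed.

(** The highest points above distinct leaves are separated: each is at least [a] above its leaf, and
    their meet is no higher than either leaf. *)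
Lemma trimmed_leaf_le_covering (a : R) : 0 < a ->
  (trimmed_leaf_number O a <= covering_number wc a)%E.
Proof.
move=> a0.
have : forall z, exists y, below z y /\ height z = level y - level z.
  by move=> z; have [y] := height_attained w_min z; exists y.
move=> /choice[f hf]; apply: (@packing_le_covering _ _ f).
move=> z z' lz lz' zz'.
have [zy hz] := hf z; have [zy' hz'] := hf z'.
have [m [my my' ->]] := meet_exists (f z) (f z').
(* Were [m] higher than [z1], then [z1] would be below [f z2], hence comparable with [z2], which is
   impossible for distinct leaves. *)
have key z1 z2 : leaves a z1 -> leaves a z2 -> z1 <> z2 -> below m (f z1) ->
    below m (f z2) -> level m <= level z1.
  move=> [l1 l1'] [l2 l2'] ne m1 m2; have [h1 _] := hf z1; have [h2 _] := hf z2.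
  rewrite leNgt; apply/negP => /ltW z1m.
  have z12 : below z1 (f z2) by exact: below_trans (below_comparable h1 m1 z1m)
    m2.
  have [|/ltW] := leP (level z1) (level z2) => lz12.
    apply: ne; apply/esym/l1' => //.
    by apply/(arcP w_min); exact: below_comparable z12 h2 lz12.
  apply: ne; apply: l2' => //.
  by apply/(arcP w_min); exact: below_comparable h2 z12 lz12.
have := key _ _ lz lz' zz' my my'.
have := key _ _ lz' lz (nesym zz') my' my.
case: lz => [+ _]; case: lz' => [+ _]; rewrite /trimmed_tree /=; lra.
Qed.

Variable lambda : {measure set (tree_borel wc) -> \bar R}.
Hypothesis lambda_length : is_length_measure O lambda.

Lemma below_measurable x :
  measurable ([set z | below z x] : set (tree_borel wc)).
Proof. by apply: closed_measurable_tree; exact: closed_below. Qed.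

Lemma lambda_below x : lambda [set z | below z x] = (level x - level O)%:E.
Proof.
have [_ /(_ O x)] := lambda_length; rewrite (below_root w_min x) => <-.
by congr (lambda _); apply/seteqP; split=> z /arcP; apply.
Qed.

(** Half-open, so as to be a difference of two arcs issued from the root, whose measures
    [lambda_below] gives. *)
Definition slab x (u v : R) : set T := [set z | below z x /\ u < level z <= v].

Lemma slabE x (u v : R) : level O <= u -> u <= v -> v <= level x ->
  exists y y', [/\ slab x u v = [set z | below z y] `\` [set z | below z y'],
    below y' y, level y = v & level y' = u].
Proof.
move=> Ou uv vx.
have [|y [yx ly]] := @below_exists _ _ wc U x v; first by rewrite (le_trans Ou).
have [|y' [y'x ly']] := @below_exists _ _ wc U x u.
  by rewrite Ou (le_trans uv).
exists y, y'; split => //; last by apply: below_comparable y'x yx _;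
  rewrite ly ly'.
apply/seteqP; split=> z /=.
  move=> [zx /andP[uz zv]]; split; last by move=> /below_level; lra.
  by apply: below_comparable zx yx _; rewrite ly.
move=> [zy zy']; have zx := below_trans zy yx; split => //.
rewrite -ly below_level// andbT ltNge; apply/negP => zu; apply: zy'.
by apply: below_comparable zx y'x _; rewrite ly'.
Qed.

Lemma slab_measurable x (u v : R) : level O <= u -> u <= v -> v <= level x ->
  measurable (slab x u v : set (tree_borel wc)).
Proof.
move=> Ou uv vx; have [y [y' [-> _ _ _]]] := slabE Ou uv vx.
by apply: measurableD; exact: below_measurable.
Qed.

Lemma lambda_slab x (u v : R) : level O <= u -> u <= v -> v <= level x ->
  lambda (slab x u v) = (v - u)%:E.
Proof.
move=> Ou uv vx; have [y [y' [-> y'y ly ly']]] := slabE Ou uv vx.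
rewrite (measureD (below_measurable y) (below_measurable y')); last first.
  by rewrite [ltLHS]lambda_below ltry.
rewrite (_ : _ `&` _ = [set z | below z y']); last first.
  apply/seteqP; split=> z /=; first by case.
  by move=> zy'; split => //; exact: below_trans y'y.
rewrite [X in (X - _)%E](lambda_below y) [X in (_ - X)%E](lambda_below y').
by rewrite -EFinB ly ly'; congr EFin; lra.
Qed.

(* A point of T^a outside T^b is less than b - a below some leaf of T^a. *)
Lemma lambda_trimmed_leaves (a b : R) : 0 < a -> a < b ->
  (lambda (trimmed_tree O a) <=
   lambda (trimmed_tree O b) + (b - a)%:E * trimmed_leaf_number O a)%E.
Proof.
move=> a0 ab; have ba0 : 0 < b - a by rewrite subr_gt0.
(* With infinitely many leaves the right-hand side is infinite. *)
rewrite /trimmed_leaf_number /counting; case: asboolP => [fl|_]; last first.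
  by rewrite mulry gtr0_sg// mul1e addey ?leey// gt_eqF// (lt_le_trans _
    (measure_ge0 _ _)).
pose S z := [set x | below x z] `&` [set x | level z - (b - a) < level x].
have Sm z : measurable (S z : set (tree_borel wc)).
  apply: measurableI; first exact: below_measurable.
  apply: open_measurable_tree.
  apply: (@open_comp _ _ (@level _ _ wc) [set r : R | level z - (b - a) < r]).
    by move=> ? _; exact: level_continuous.
  exact: open_gt.
have Sle z : (lambda (S z) <= (b - a)%:E)%E.
  (* If the segment would reach past the root, the whole arc from the root to [z] is already short
     enough. *)
  have [zO|Oz] := leP (level z - (b - a)) (level O).
    apply: le_trans (_ : lambda [set x | below x z] <= _)%E.
      apply: le_measure; rewrite ?inE//; last by move=> x [].
      exact: below_measurable.
    by rewrite [leLHS]lambda_below lee_fin; move: zO; clear; lra.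
  rewrite (_ : S z = slab z (level z - (b - a)) (level z)).
    have bz : level z - (b - a) <= level z by move: ba0; clear; lra.
    rewrite [leLHS](lambda_slab (ltW Oz) bz (lexx _)) lee_fin; clear; lra.
  apply/seteqP; split=> x /= [xz h]; split => //; last by case/andP: h.
  by rewrite h below_level.
have cover : trimmed_tree O a `<=` trimmed_tree O b `|` \bigcup_(z in leaves a)
  S z.
  move=> x xa; have [xb|xb] := leP b (height x); [by left|right].
  have [z [lz xz e]] := leaf_above (ltW a0) xa.
  exists z => //; split => //=; move: e xb; clear; lra.
have mU : measurable (\bigcup_(z in leaves a) S z : set (tree_borel wc)).
  by apply: fin_bigcup_measurable.
have mT c := trimmed_tree_measurable w_min c.
apply: le_trans (_ : lambda (trimmed_tree O b `|` \bigcup_(z in leaves a) S z)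
  <= _)%E.
  by apply: le_measure; rewrite ?inE//; exact: measurableU.
apply: (le_trans (measureU2 _ _ _)) => //; rewrite leeD2l//.
have := content_sub_fsum lambda fl (fun z _ => Sm z) mU (@subset_refl _ _).
move=> /le_trans; apply.
rewrite fsbig_finite//=.
by apply: sume_le_const.
Qed.

Lemma le_lambda_trimmed (a b : R) : a <= b ->
  (lambda (trimmed_tree O b) <= lambda (trimmed_tree O a))%E.
Proof.
move=> ab; apply: le_measure; rewrite ?inE; try exact: trimmed_tree_measurable.
by move=> x; rewrite /trimmed_tree /=; exact: le_trans.
Qed.

Lemma slab_trimmed x (u v a : R) : v + a <= level x ->
  slab x u v `<=` trimmed_tree O a.
Proof.
by move=> vax z [/(height_ge w_min) + /andP[_ zv]]; rewrite /trimmed_tree /=;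
  lra.
Qed.

(** The arc from [O] to [x], shortened by [a] at its top, lies in the trimmed tree. *)
Lemma lambda_trimmed_ge x (a : R) : 0 <= a ->
  ((level x - level O - a)%:E <= lambda (trimmed_tree O a))%E.
Proof.
move=> a0; have [|/ltW h] := leP (level x - level O - a) 0.
  by move=> h; apply: (le_trans _ (measure_ge0 _ _)); rewrite lee_fin.
have -> : level x - level O - a = level x - a - level O by lra.
have h1 : level O <= level x - a by lra.
have h2 : level x - a <= level x by lra.
rewrite -(lambda_slab (lexx _) h1 h2).
apply: le_measure; rewrite ?inE; first exact: slab_measurable.
  exact: trimmed_tree_measurable.
by apply: slab_trimmed; lra.
Qed.

Lemma below_between y s t (u : R) : below y (\pi_T s) -> below y (\pi_T t) ->
  between (val s) (val t) u -> level y <= w u.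
Proof.
elim/tree_ind: y => r /belowP rs /belowP rt; rewrite level_pi.
by case/(between_split (val r)) => [|]; [rewrite betweenC => /rs|move/rt].
Qed.

(* Cutting at multiples of a turns separated oscillations of size 2 a into
   disjoint segments of length a / 2 of the trimmed tree. *)
Lemma oscillations_le_length (J : {fset nat}) (b c : nat -> I) (a : R) :
  0 < a ->
  (forall i, i \in J -> w (val (b i)) + 2 * a <= w (val (c i))) ->
  (forall i j, i \in J -> j \in J -> i != j ->
     between (val (c i)) (val (c j)) (val (b i)) \/
     between (val (c i)) (val (c j)) (val (b j))) ->
  ((#|` J |%:R * (a / 2))%:E <= lambda (trimmed_tree O (a / 2)))%E.
Proof.
move=> a0 osc sep.
(* Rounding [w (val (b i))] up to a multiple [x i] of [a] costs less than [a] of the oscillation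
   [2 * a], so [x i + a / 2] is still at least [a / 2] below the level of [c i]. *)
pose k i : int := Num.ceil (w (val (b i)) / a).
pose x i : R := (k i)%:~R * a.
have bx i : w (val (b i)) <= x i.
  by rewrite -ler_pdivrMr//; exact: ceil_ge.
have xb i : x i < w (val (b i)) + a.
  have := ceilB1_lt (w (val (b i)) / a).
  by rewrite intrB ltrBlDr -(ltr_pM2r a0) mulrDl mul1r divfK ?gt_eqF.
have x_eq i j (l : R) : x i < l <= x i + a / 2 -> x j < l <= x j + a / 2 ->
    x i = x j.
  move=> /andP[l1 l2] /andP[l3 l4].
  suff kij : k i = k j by rewrite /x kij.
  have h1 : x i < x j + a by lra.
  have h2 : x j < x i + a by lra.
  have xS m : x m + a = (k m + 1)%:~R * a by rewrite intrD mulrDl mul1r.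
  rewrite !xS !ltr_pM2r// !ltr_int !ltzD1 in h1 h2.
  by apply/eqP; rewrite eq_le h1 h2.
have Ox i : level O <= x i by rewrite level_pi (le_trans (w_min (b i))).
have hc i : i \in J -> x i + a / 2 + a / 2 <= level (\pi_T (c i)).
  by move=> /osc; rewrite level_pi; have := xb i; lra.
have hc' i : i \in J -> x i + a / 2 <= level (\pi_T (c i)).
  by move=> /hc; lra.
have hx i : x i <= x i + a / 2 by lra.
have hxa i : x i + a / 2 - x i = a / 2 by lra.
pose S i := slab (\pi_T (c i)) (x i) (x i + a / 2).
have Sm i : i \in J -> measurable (S i : set (tree_borel wc)).
  by move=> iJ; apply: slab_measurable => //; exact: hc'.
(* A point common to two slabs is below both tops, so [w] is at least its level between the times
   [c i] and [c j]. But one of [b i], [b j] lies there, and [w] is smaller at that time. *)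
have St : trivIset [set` J] S.
  apply/trivIsetP => i j /= iJ jJ ij.
  rewrite -subset0 => y [[yi li] [yj lj]].
  have xij := x_eq _ _ _ li lj.
  have {}li : w (val (b i)) < level y by case/andP: li => /(le_lt_trans (bx
    i)).
  have {}lj : w (val (b j)) < level y by case/andP: lj => /(le_lt_trans (bx
    j)).
  case: (sep _ _ iJ jJ ij) => /(below_between yi yj).
    by rewrite leNgt li.
  by rewrite leNgt lj.
rewrite (_ : (_ * _)%:E = \sum_(i <- J) lambda (S i))%E.
  rewrite -measure_fbigsetU//; apply: le_measure; rewrite ?inE.
  - by rewrite -bigcup_fset; apply: fin_bigcup_measurable.
  - exact: trimmed_tree_measurable.
  - by rewrite -bigcup_fset; apply: bigcup_sub => i iJ; apply: slab_trimmed;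
    exact: hc.
transitivity (\sum_(i <- J) (a / 2)%:E)%E.
  by rewrite sumEFin big_const_seq count_predT iter_addr_0 mulr_natl.
apply: eq_big_seq => i iJ; rewrite [RHS]lambda_slab//; last exact: hc'.
by rewrite hxa.
Qed.

End tree_measure.

(** * Growth exponents and power bounds *)

(** Reduces a comparison of exponents to real numbers [r] above the larger one, for which
    [growth_exponent_lt] provides a power bound. *)
Lemma lee_ltEFin (R : realType) (x y : \bar R) :
  (forall r : R, (y < r%:E)%E -> (x <= r%:E)%E) -> (x <= y)%E.
Proof.
move=> h; case: y h => [y||] h; last 2 first.
- exact: leey.
- case: x h => [x||//] h; last by have := h 0 (ltNyr _); rewrite leye_eq.
  by exfalso; have := h (x - 1) (ltNyr _); rewrite lee_fin lerBrDr gerDl ler10.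
- by apply/lee_addgt0Pr => e e0; rewrite -EFinD; apply: h;
  rewrite lte_fin ltrDl.
Qed.

(** With [K] the logarithm of a multiplicative constant, that constant changes an exponent by at
    most [e]. *)
Lemma ln_inv_large (R : realType) (K e : R) : 0 < e ->
  exists2 d : R, 0 < d & forall a, 0 < a < d ->
    0 < ln a^-1 /\ `|K| <= e * ln a^-1.
Proof.
move=> e0; exists (expR (- (`|K| / e))); first exact: expR_gt0.
move=> a /andP[a0 ad].
have h : `|K| / e < ln a^-1.
  rewrite lnV ?posrE// ltrNr.
  by move: ad; rewrite -ltr_ln ?posrE ?expR_gt0// expRK.
split; first by apply: le_lt_trans h; rewrite divr_ge0// ltW.
by rewrite mulrC -ler_pdivrMr// ltW.
Qed.

Lemma powRN_ln (R : realType) (a r : R) : 0 < a ->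
  a `^ (- r) = expR (r * ln a^-1).
Proof. by move=> a0; rewrite /powR gt_eqF// lnV ?posrE// mulrN mulNr. Qed.

Section growth_exponent.
Variable R : realType.
Implicit Types (f : R -> \bar R) (r c d C : R).

(** The upper limit is an infimum of suprema over neighbourhoods, so one of these suprema is already
    less than [r]. *)
Lemma growth_exponent_lt f r : (growth_exponent f < r%:E)%E ->
  exists2 d, 0 < d & forall a, 0 < a < d -> (f a <= (a `^ (- r))%:E)%E.
Proof.
rewrite /growth_exponent limf_esupE => /ereal_inf_lt[_ [V V0 <-] Vr].
have [d1 /= d10 hd1] : exists2 e : R, 0 < e & forall a, 0 < a < e -> V a.
  move: V0; rewrite /at_right /within /= => /nbhs_ballP[e /= e0 he].
  exists e => // a /andP[a0 ae]; apply: he => //.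
  by rewrite /ball /= sub0r normrN gtr0_norm.
have [d2 d20 hd2] := @ln_inv_large R 0 1 ltr01.
exists (Num.min d1 d2); first by rewrite lt_min d10.
move=> a /andP[a0]; rewrite lt_min => /andP[ad1 ad2].
have [|L0 _] := hd2 a; first by rewrite a0.
have : (lne (f a) * (ln a^-1)^-1%:E <= r%:E)%E.
  apply: le_trans (ltW Vr); apply: ereal_sup_ubound; exists a => //.
  by apply: hd1; rewrite a0.
rewrite powRN_ln//.
(* An infinite [f a] would make the quotient infinite; a nonpositive one satisfies the bound
   trivially. *)
case: (f a) => [y| |]; last 2 first.
- by rewrite /= mulyr gtr0_sg ?invr_gt0// mul1e leye_eq.
- by rewrite leNye.
have [y0|y0] := leP y 0.
  by move=> _; rewrite lee_fin (le_trans y0)// expR_ge0.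
rewrite lne_EFin// -EFinM !lee_fin ler_pdivrMr// => h.
by rewrite -ler_ln ?posrE ?expR_gt0// expRK.
Qed.

Lemma growth_exponent_le f r C d : 0 < C -> 0 < d ->
  (forall a, 0 < a < d -> (f a <= (C * a `^ (- r))%:E)%E) ->
  (growth_exponent f <= r%:E)%E.
Proof.
move=> C0 d0 hf; apply/lee_addgt0Pr => e e0.
have [d2 d20 hd2] := @ln_inv_large R (ln C) e e0.
rewrite /growth_exponent limf_esupE; apply: (@le_trans _ _ (ereal_sup
   ((fun a : R => lne (f a) * (ln a^-1)^-1%:E)%E @` [set a | 0 < a < Num.min d
     d2]))).
  apply: ereal_inf_lbound; exists [set a | 0 < a < Num.min d d2] => //.
  have m0 : 0 < Num.min d d2 by rewrite lt_min d0.
  near=> a; apply/andP; split; near: a; first exact: nbhs_right_gt.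
  exact: nbhs_right_lt.
apply: ge_ereal_sup => _ [a /= /andP[a0 +] <-]; rewrite lt_min => /andP[ad ad2].
have [|L0 hC] := hd2 a; first by rewrite a0.
have := hf a; rewrite a0 ad => /(_ isT); rewrite powRN_ln//.
have lnC : ln C <= e * ln a^-1 by apply: le_trans hC; exact: ler_norm.
case: (f a) => [y| |]; last 2 first.
- by rewrite leye_eq.
- by move=> _; rewrite /= mulNyr gtr0_sg ?invr_gt0// mul1e leNye.
rewrite lee_fin => hy; have [y0|y0] := leP y 0.
  by rewrite le0_lneNy ?lee_fin// mulNyr gtr0_sg ?invr_gt0// mul1e leNye.
rewrite lne_EFin// -EFinM -EFinD lee_fin ler_pdivrMr// mulrDl.
move: hy; rewrite -ler_ln ?posrE ?mulr_gt0 ?expR_gt0// lnM ?posrE ?expR_gt0//.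
by rewrite expRK; lra.
Unshelve. all: by end_near.
Qed.

Lemma growth_exponent_ge f r c d : 0 < c -> 0 < d ->
  (forall a, 0 < a < d -> ((c * a `^ (- r))%:E <= f a)%E) ->
  (r%:E <= growth_exponent f)%E.
Proof.
move=> c0 d0 hf; rewrite /growth_exponent limf_esupE.
apply: le_ereal_inf_tmp => _ [V V0 <-].
apply/lee_addgt0Pr => e e0.
have [d2 d20 hd2] := @ln_inv_large R (ln c) e e0.
have m0 : 0 < Num.min d d2 by rewrite lt_min d0.
have [a [Va a0]] : exists a, V a /\ 0 < a < Num.min d d2.
  have : \forall a \near 0^'+, V a /\ 0 < a < Num.min d d2.
    near=> a; split; first by near: a.
    apply/andP; split; near: a; first exact: nbhs_right_gt.
    exact: nbhs_right_lt.
  by move=> /(@filter_ex _ _ (at_right_proper_filter 0)).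
move: a0; rewrite lt_min => /and3P[a0 ad ad2].
have [|L0 hC] := hd2 a; first by rewrite a0.
have := hf a; rewrite a0 ad => /(_ isT); rewrite powRN_ln// => hy.
have lnC : - ln c <= e * ln a^-1.
  by apply: le_trans hC; rewrite -normrN; exact: ler_norm.
apply: (@le_trans _ _ (lne (f a) * (ln a^-1)^-1%:E + e%:E)%E); last first.
  by apply: leeD => //; apply: ereal_sup_ubound; exists a.
have cE0 : 0 < c * expR (r * ln a^-1) by rewrite mulr_gt0 ?expR_gt0.
case: (f a) hy => [y| |//]; last first.
  by move=> _; rewrite /= mulyr gtr0_sg ?invr_gt0// mul1e leey.
rewrite lee_fin => hy; have y0 := lt_le_trans cE0 hy.
rewrite lne_EFin// -EFinM -EFinD lee_fin -lerBlDr ler_pdivlMr//.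
move: hy; rewrite -ler_ln ?posrE// lnM ?posrE ?expR_gt0// expRK mulrBl; lra.
Unshelve. all: by end_near.
Qed.

End growth_exponent.

(** * Variation sums along subdivisions *)

Section p_variation.
Variables (R : realType) (w : R -> R) (p : R).
Hypothesis p1 : 1 <= p.

Fixpoint variation_sum (x : R) (s : seq R) : R :=
  if s is y :: s' then `|w y - w x| `^ p + variation_sum y s' else 0.

Lemma variation_sumE (d x : R) (s : seq R) :
  \sum_(0 <= i < size s) `|w (nth d (x :: s) i.+1) - w (nth d (x :: s) i)| `^ p
  = variation_sum x s.
Proof.
elim: s x => [|y s ih] x; first by rewrite big_nil.
by rewrite big_nat_recl//= ih.
Qed.

Lemma variation_sum_ge0 x s : 0 <= variation_sum x s.
Proof. by elim: s x => //= y s ih x; rewrite addr_ge0 ?powR_ge0. Qed.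

Lemma variation_sum_cat x s1 s2 :
  variation_sum x (s1 ++ s2) =
    variation_sum x s1 + variation_sum (last x s1) s2.
Proof. by elim: s1 x => [|y s1 ih] x /=; rewrite ?add0r// ih addrA. Qed.

Lemma strict_subdivision x s : path <=%R x s -> exists s',
  [/\ path <%R x s', last x s' = last x s &
      variation_sum x s' = variation_sum x s].
Proof.
elim: s x => [|y s ih] x /=; first by exists [::].
move=> /andP[xy /ih[s' [ps' ls' vs']]].
move: xy; rewrite le_eqVlt => /orP[/eqP xy|xy].
  exists s'; rewrite xy subrr normr0 powR0 ?add0r//.
  by rewrite gt_eqF// (lt_le_trans _ p1).
by exists (y :: s'); split => //=; rewrite ?xy ?vs'.
Qed.

Lemma variation_sum_le x s : 0 <= x -> path <=%R x s -> last x s <= 1 ->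
  ((variation_sum x s)%:E <= p_variation p w)%E.
Proof.
move=> x0 xs s1.
(* Adding the endpoints [0] and [1] only adds nonnegative terms. *)
have [|s' [ps' ls' vs']] := @strict_subdivision 0 (x :: rcons s 1).
  by rewrite /= x0 rcons_path xs.
apply: (@le_trans _ _ (variation_sum 0 s')%:E).
  rewrite vs' lee_fin /= -cats1 variation_sum_cat.
  rewrite addrA (addrC (_ `^ _)) -addrA lerDl.
  by rewrite addr_ge0 ?powR_ge0 ?variation_sum_ge0.
apply: ereal_sup_ubound; exists s'; last by rewrite (variation_sumE 1).
by split; rewrite ?ls' //= last_rcons.
Qed.

End p_variation.

(** * Separated times and covering numbers *)

Section separated_times.
Variables (R : realType) (w : R -> R).
Hypothesis wc : {within `[0, 1], continuous w}.
Local Notation T := (tree wc).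
Local Notation I := (unit_itv R).
Implicit Types (s t : I).

(* The optimal constant a / 2 would require the infimum to be attained. *)
Lemma oscillation_between s t (a : R) : 0 < a ->
  a <= path_dist w (val s) (val t) ->
  exists2 u, between (val s) (val t) u &
    a / 3 <= `|w u - w (val s)| \/ a / 3 <= `|w (val t) - w u|.
Proof.
move=> a0 ast; apply: contrapT => /forall2NP h.
(* With all these increments less than [a / 3], the distance is at most [2 * (a / 3)], less than
   [a]. *)
have : Num.max (w (val s)) (w (val t)) - a / 3 <= path_inf w (val s) (val t).
  apply: path_inf_glb => u stu; have [//|/not_orP[]] := h u.
  move=> /negP; rewrite -ltNge ltr_norml => /andP[? ?].
  move=> /negP; rewrite -ltNge ltr_norml => /andP[? ?].
  by rewrite maxEle; case: ifP => _; lra.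
have := le_max (w (val s)) (w (val s)) (w (val t)); rewrite lexx => /= h1.
have := le_max (w (val t)) (w (val s)) (w (val t)); rewrite lexx orbT => h2.
by move: ast; rewrite /path_dist; lra.
Qed.

Definition separated_le (a : R) s t : bool :=
  (val s <= val t) && (a <= path_dist w (val s) (val t)).

Lemma separated_variation (p a : R) t ts : 0 < a -> 1 <= p ->
  path (separated_le a) t ts ->
  exists us, [/\ path <=%R (val t) us, last (val t) us = val (last t ts) &
    (size ts)%:R * (a / 3) `^ p <= variation_sum w p (val t) us].
Proof.
move=> a0 p1; elim: ts t => [|t' ts ih] t /=.
  by exists [::]; split => //=; rewrite mul0r.
move=> /andP[/andP[tt' att'] /ih[us [ps ls vs]]].
have [u /andP[]] := oscillation_between a0 att'.
rewrite (min_idPl tt') (max_idPr tt') => tu ut' hu.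
exists (u :: val t' :: us); split => //=; first by rewrite tu ut'.
rewrite -natr1 mulrDl mul1r addrC addrA lerD//.
have pmono (x y : R) : 0 <= x -> x <= y -> x `^ p <= y `^ p.
  by move=> x0 xy; apply: ge0_ler_powR; rewrite ?nnegrE// (le_trans _ xy,
    le_trans ler01).
have a30 : 0 <= a / 3 by rewrite divr_ge0// ltW.
by case: hu => /(pmono _ _ a30) hu; [rewrite ler_wpDr ?powR_ge0|rewrite
  ler_wpDl ?powR_ge0].
Qed.

Definition separated (a : R) (ts : seq I) : Prop := uniq ts /\
  {in ts &, forall s t, s != t -> a <= path_dist w (val s) (val t)}.

Lemma p_variation_ge0 (p : R) : 1 <= p -> (0 <= p_variation p w)%E.
Proof.
by move=> p1; have := @variation_sum_le _ w p p1 0 [::] (lexx _) isT ler01.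
Qed.

(** Sort the times; there is one gap fewer than times, whence the extra term on the right. *)
Lemma separated_size (p a : R) ts : 0 < a -> 1 <= p -> separated a ts ->
  (((size ts)%:R * (a / 3) `^ p)%:E <= ((a / 3) `^ p)%:E + p_variation p w)%E.
Proof.
move=> a0 p1 [uts sep].
pose le s t : bool := val s <= val t.
have le_tr : transitive le by move=> ? ? ?; exact: le_trans.
have le_total : total le by move=> ? ?; exact: le_total.
have : sorted (separated_le a) (sort le ts).
  have : pairwise le (sort le ts) by rewrite -sorted_pairwise// sort_sorted.
  have : pairwise [rel x y | x != y] (sort le ts) by rewrite -uniq_pairwise
    sort_uniq.
  move=> h1 h2; apply: pairwise_sorted.
  have : pairwise [rel x y | le x y && (x != y)] (sort le ts).
    by rewrite pairwise_relI h1 h2.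
  apply: sub_in_pairwise (allss _) => s t; rewrite !mem_sort => sin tin /=
    /andP[st ne].
  by apply/andP; split => //; exact: sep.
have := size_sort le ts; case: (sort le ts) => [|t ts'] <- /=.
  by rewrite mul0r adde_ge0 ?lee_fin ?powR_ge0 ?p_variation_ge0.
move=> /(separated_variation a0 p1)[us [ps ls vs]].
rewrite -natr1 mulrDl mul1r addrC EFinD leeD2l//.
apply: (@le_trans _ _ (variation_sum w p (val t) us)%:E);
  first by rewrite lee_fin.
apply: variation_sum_le => //; first by case/andP: (unit_itvP t).
by rewrite ls; case/andP: (unit_itvP (last t ts')).
Qed.

Lemma covering_le_variation (p a : R) : 0 < a -> 1 <= p ->
  (p_variation p w < +oo)%E ->
  (covering_number wc a <= (1 + fine (p_variation p w) / (a / 3) `^ p)%:E)%E.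
Proof.
move=> a0 p1 Vfin.
have Vreal : p_variation p w \is a fin_num by rewrite ge0_fin_numE//
  p_variation_ge0.
set V := fine _.
have a3 : 0 < (a / 3) `^ p by rewrite powR_gt0// divr_gt0.
have bound ts : separated a ts -> (size ts)%:R <= 1 + V / (a / 3) `^ p.
  move=> /(separated_size a0 p1); rewrite -(fineK Vreal) -EFinD lee_fin.
  by rewrite -ler_pdivlMr// mulrDl divff ?gt_eqF.
(* The sizes of separated families are bounded, so a largest one exists; the balls around its points
   cover the tree, since an uncovered point could be added to it. *)
pose P n := `[< exists ts, size ts = n /\ separated a ts >].
have exP : exists n, P n by exists 0%N; apply/asboolP; exists [::].
have ubP n : P n -> (n <= Num.bound (1 + V / (a / 3) `^ p))%N.
  move=> /asboolP[ts [<- /bound h]]; rewrite ltnW// -(ltr_nat R).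
  apply: (le_lt_trans h); apply: archi_boundP.
  by rewrite addr_ge0// divr_ge0 ?fine_ge0 ?p_variation_ge0// ltW.
case: (ex_maxnP exP ubP) => n /asboolP[ts [<- septs]] maxn.
apply: (@le_trans _ _ (counting [set \pi_T t | t in [set` ts]])); last first.
  apply: (@le_trans _ _ (counting `I_(size ts))); last first.
    rewrite /counting asboolT ?lee_fin; last exact: finite_II.
    by rewrite (card_fset_set (card_eqxx _)) bound.
  apply: card_le_counting; apply: card_le_trans (card_image_le _ _) _.
  have inj : {in [set` ts] &, injective (index^~ ts)}.
    move=> s s' /set_mem /= sts /set_mem /= s'ts e.
    by rewrite -(nth_index s sts) e nth_index.
  rewrite -(card_le_eql (inj_card_eq inj)); apply: subset_card_le.
  by move=> _ [s sts <-] /=; rewrite index_mem.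
apply: ereal_inf_lbound; exists [set \pi_T t | t in [set` ts]] => //=.
apply/seteqP; split => // x _; elim/tree_ind: x => t.
apply: contrapT => nt.
have sept t' : t' \in ts -> a <= path_dist w (val t') (val t).
  move=> t'ts; rewrite leNgt; apply/negP => h; apply: nt.
  by exists (\pi_T t'); [exists t'|rewrite ballEmdist /= mdist_pi].
have : P (size (t :: ts)).
  apply/asboolP; exists (t :: ts); split => //; case: septs => uts hts.
  split=> /=; first by rewrite uts andbT; apply/negP => /sept;
    rewrite path_dist_refl leNgt a0.
  move=> s s'; rewrite !inE => /predU1P[->|sts] /predU1P[->|s'ts] //.
  - by rewrite eqxx.
  - by move=> _; rewrite path_dist_sym sept.
  - by move=> _; exact: sept.
  - exact: hts.
by move=> /maxn /=; rewrite ltnn.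
Qed.

End separated_times.

(** * Dyadic scales *)

Section dyadic.
Variable R : realType.
Implicit Types (D p q r s x K : R).

Definition dyadic D (n : nat) : R := D / 2 ^+ n.

Lemma dyadic_gt0 D n : 0 < D -> 0 < dyadic D n.
Proof. by move=> D0; rewrite divr_gt0// exprn_gt0. Qed.

Lemma dyadicS D n : dyadic D n.+1 = dyadic D n / 2.
Proof. by rewrite /dyadic exprSr invfM mulrA. Qed.

Lemma dyadic_le D n : 0 <= D -> dyadic D n <= D.
Proof. by move=> D0; rewrite ler_pdivrMr ?exprn_gt0// ler_peMr// exprn_ege1//
  ler1n. Qed.

Lemma dyadic_small D x : 0 < D -> 0 < x -> exists n, dyadic D n <= x.
Proof.
move=> D0 x0; exists (Num.bound (D / x)).
rewrite /dyadic ler_pdivrMr ?exprn_gt0// mulrC -ler_pdivrMr//.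
have Dx : 0 <= D / x by rewrite divr_ge0// ltW.
apply: (le_trans (ltW (archi_boundP Dx))).
by rewrite -natrX ler_nat ltnW// ltn_expl.
Qed.

Lemma dyadic_powR D s n : 0 < D ->
  dyadic D n `^ s = D `^ s * (2^-1 `^ s) ^+ n.
Proof.
move=> D0; have h0 : 0 <= 2^-1 :> R by rewrite invr_ge0.
rewrite /dyadic -exprVn powRM ?exprn_ge0//; last exact: ltW.
congr (_ * _); rewrite -(powR_mulrn n h0).
by rewrite -(powR_mulrn n (powR_ge0 _ s)) powRAC.
Qed.

Lemma dyadic_series_lty D s K : 0 < D -> 0 < s -> 0 <= K ->
  (\sum_(0 <= n <oo) (K * dyadic D n `^ s)%:E < +oo)%E.
Proof.
move=> D0 s0 K0.
have q1 : `|2^-1 `^ s| < 1 :> R.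
  have e1 : 1 `^ s = 1 :> R by rewrite powR1.
  rewrite ger0_norm ?powR_ge0// -[ltRHS]e1.
  by apply: gt0_ltr_powR => //; rewrite ?nnegrE ?invr_ge0// invf_lt1// ltr1n.
have := @is_cvg_geometric_series _ (K * D `^ s) _ q1.
move=> cv.
rewrite (_ : (\sum_(0 <= n <oo) _)%E = (limn (series (geometric (K * D `^ s)
  (2^-1 `^ s))))%:E).
  exact: ltry.
rewrite -EFin_lim//; apply: congr_lim; apply/funext => n /=.
rewrite /series /= -sumEFin; apply: eq_bigr => i _.
by rewrite dyadic_powR// /geometric /= mulrA.
Qed.

(** For [x] positive a single term suffices, that of the least [n] with [dyadic D n.+1 <= x]. *)
Lemma powR_le_dyadic D p x : 0 < p -> 0 <= x <= D ->
  ((x `^ p)%:E <=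
   \sum_(0 <= n <oo) (dyadic D n `^ p * (dyadic D n.+1 <= x)%R%:R)%:E)%E.
Proof.
move=> p0 /andP[x0 xD].
have term0 n : (0 <= (dyadic D n `^ p * (dyadic D n.+1 <= x)%R%:R)%:E)%E.
  by rewrite lee_fin mulr_ge0 ?powR_ge0// ler0n.
move: x0; rewrite le_eqVlt => /orP[/eqP x0|x0].
  by rewrite -{1}x0 powR0 ?gt_eqF//; apply: nneseries_ge0 => n _ _;
    exact: term0.
have exn : exists n, dyadic D n.+1 <= x.
  have [n hn] := dyadic_small (lt_le_trans x0 xD) x0; exists n.
  apply: le_trans hn; rewrite dyadicS ler_pdivrMr// ler_peMr ?ler1n//.
  by rewrite ltW// dyadic_gt0// (lt_le_trans x0).
case: (ex_minnP exn) => n hn nmin.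
apply: le_trans (nneseries_lim_ge n.+1 _) => //.
rewrite big_nat_recr//= hn mulr1.
apply: (@le_trans _ _ (dyadic D n `^ p)%:E).
  rewrite lee_fin; apply: ge0_ler_powR; rewrite ?nnegrE ?(ltW p0) ?(ltW x0)//.
    by rewrite divr_ge0 ?exprn_ge0// (le_trans _ xD)// ltW.
  (* [x <= dyadic D n] is the hypothesis [x <= D] for [n = 0], and the minimality of [n]
     otherwise. *)
  case: n hn nmin => [|n] hn nmin; first by rewrite /dyadic expr0 divr1.
  rewrite leNgt; apply/negP => /ltW /nmin; by rewrite ltnn.
by rewrite leeDr// sume_ge0.
Qed.

End dyadic.

(** * Integrals of powers of the height *)

Section trimmed_length_bound.
Variables (R : realType) (w : R -> R).
Hypothesis wc : {within `[0, 1], continuous w}.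
Local Notation T := (tree wc).
Local Notation I := (unit_itv R).
Variable U : I.
Hypothesis w_min : forall t : I, w (val U) <= w (val t).
Local Notation O := (\pi_T U).
Local Notation height := (height O).
Variable lambda : {measure set (tree_borel wc) -> \bar R}.
Hypothesis lambda_length : is_length_measure O lambda.
Local Notation L a := (lambda (trimmed_tree O a)).

Lemma height_powR_measurable (p : R) :
  measurable_fun [set: tree_borel wc] (fun x => (height x `^ p)%:E).
Proof.
apply/measurable_EFinP; apply: (measurableT_comp (measurable_powR p)).
exact: height_measurable.
Qed.

Lemma indic_trimmed_measurable (a : R) :
  measurable_fun [set: tree_borel wc]
    (fun x => (\1_(trimmed_tree O a) x)%:E : \bar R).
Proof.
apply/measurable_EFinP; apply: measurable_indic; exact: trimmed_tree_measurable.
Qed.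

Lemma integral_trimmed (a k : R) : 0 <= k ->
  (\int[lambda]_x (k%:E * (\1_(trimmed_tree O a) x)%:E) = k%:E * L a)%E.
Proof.
move=> k0; rewrite ge0_integralZl_EFin//; last exact: indic_trimmed_measurable.
by rewrite integral_indic// ?setIT//; exact: trimmed_tree_measurable.
Qed.

Lemma markov_height (p a : R) : 0 <= p -> 0 < a ->
  ((a `^ p)%:E * L a <= \int[lambda]_x (height x `^ p)%:E)%E.
Proof.
move=> p0 a0; rewrite -integral_trimmed ?powR_ge0//;
  apply: ge0_le_integral => //.
- by move=> x _; rewrite -EFinM lee_fin mulr_ge0 ?powR_ge0.
- by apply: measurable_funeM; exact: indic_trimmed_measurable.
- exact: height_powR_measurable.
move=> x _; rewrite -EFinM lee_fin indicE.
have [xa|] := boolP (x \in trimmed_tree O a); last by rewrite mulr0 powR_ge0.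
rewrite mulr1; apply: ge0_ler_powR; rewrite ?nnegrE ?(ltW a0)//.
  exact: height_ge0.
by move: xa; rewrite inE.
Qed.

Variables (D C r : R).
Hypotheses (D0 : 0 < D) (C0 : 0 <= C) (r0 : 0 <= r).
Hypothesis L_le : forall a, 0 < a <= D -> (L a <= (C * a `^ (- r))%:E)%E.

Lemma L_dyadic_le n k :
  (L (dyadic D (n + k)) <= (C * (2 ^+ k) `^ r * dyadic D n `^ (- r))%:E)%E.
Proof.
apply: le_trans (L_le _) _; first by rewrite dyadic_gt0// dyadic_le// ltW.
rewrite lee_fin -mulrA ler_wpM2l//.
have -> : dyadic D (n + k) = (2 ^+ k)^-1 * dyadic D n.
  by rewrite /dyadic exprD invfM mulrA mulrC.
rewrite powRM ?invr_ge0 ?exprn_ge0//; last by rewrite ltW// dyadic_gt0.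
have k0 : 0 <= 2 ^+ k :> R by rewrite exprn_ge0.
by rewrite -(powR_inv1 k0) -powRrM mulN1r opprK.
Qed.

Lemma height_integral_lty (p : R) : r < p -> (forall x, height x <= D) ->
  (\int[lambda]_x (height x `^ p)%:E < +oo)%E.
Proof.
move=> rp hD; have p0 : 0 < p by exact: le_lt_trans rp.
pose f n (x : tree_borel wc) : \bar R := ((dyadic D n `^ p)%:E *
  (\1_(trimmed_tree O (dyadic D n.+1)) x)%:E)%E.
have fm n : measurable_fun [set: tree_borel wc] (f n).
  by apply: measurable_funeM; exact: indic_trimmed_measurable.
have f0 n x : (0 <= f n x)%E.
  by rewrite /f -EFinM lee_fin mulr_ge0 ?powR_ge0.
apply: (@le_lt_trans _ _ (\int[lambda]_x \sum_(0 <= n <oo) f n x)%E).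
  apply: ge0_le_integral => //.
  - by move=> x _; rewrite lee_fin powR_ge0.
  - exact: height_powR_measurable.
  - by have := @ge0_emeasurable_sum _ (tree_borel wc) R setT f xpredT
      (fun n x _ _ => f0 n x) (fun n _ => fm n).
  move=> x _; apply: le_trans (powR_le_dyadic (D := D) p0 _) _.
    by rewrite hD height_ge0.
  apply: lee_nneseries => n; first by rewrite lee_fin mulr_ge0 ?powR_ge0//
    ler0n.
  move=> _; rewrite /f -EFinM lee_fin indicE;
    case: (boolP (dyadic D n.+1 <= height x)) => h.
    by rewrite mem_set.
  by rewrite memNset//=; exact/negP.
rewrite integral_nneseries//.
apply: le_lt_trans (@dyadic_series_lty _ D (p - r) (C * (2 ^+ 1) `^ r) D0 _ _);
  last 2 first.
- by rewrite subr_gt0.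
- by rewrite mulr_ge0 ?powR_ge0.
apply: lee_nneseries => n; first by move=> *; apply: integral_ge0.
move=> _; rewrite /f integral_trimmed ?powR_ge0//.
have := L_dyadic_le n 1; rewrite addn1 => /(lee_wpmul2l _ ) h.
apply: (@le_trans _ _ ((dyadic D n `^ p)%:E * (C * (2 ^+ 1) `^ r * dyadic D n
  `^ (- r))%:E)%E).
  by apply: h; rewrite lee_fin powR_ge0.
rewrite -EFinM lee_fin mulrCA -powRD//.
by apply/implyP => _; rewrite gt_eqF// dyadic_gt0.
Qed.

End trimmed_length_bound.

(** * Bounding the variation by trimmed lengths *)

Section variation_from_length.
Variables (R : realType) (w : R -> R).
Hypothesis wc : {within `[0, 1], continuous w}.
Local Notation T := (tree wc).
Local Notation I := (unit_itv R).
Variable U : I.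
Hypothesis w_min : forall t : I, w (val U) <= w (val t).
Local Notation O := (\pi_T U).
Variable lambda : {measure set (tree_borel wc) -> \bar R}.
Hypothesis lambda_length : is_length_measure O lambda.
Local Notation L a := (lambda (trimmed_tree O a)).

Lemma sum_nat_of_bool (m : nat) (P : pred nat) :
  \sum_(0 <= i < m) (P i)%:R = (count P (iota 0 m))%:R :> R.
Proof.
rewrite -natr_sum /index_iota subn0 -sum1_count [in RHS]big_mkcond /=.
by congr (_%:R); apply: eq_bigr => i _; case: (P i).
Qed.

(** Large increments are rises or falls; [oscillations_le_length] applies to each family, whence the
    factor 2. *)
Lemma count_oscillations (s : seq R) (a : R) : itv_partition 0 1 s -> 0 < a ->
  (((\sum_(0 <= i < size s)
      (2 * a <= `|w (nth 1 (0 :: s) i.+1) - w (nth 1 (0 :: s) i)|)%R%:R) * (a /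
        2))%:E
   <= 2%:E * L (a / 2))%E.
Proof.
move=> s01 a0; pose t i := nth 1 (0 :: s) i.
have t_mono i j : (i <= j)%N -> (j <= size s)%N -> t i <= t j.
  move=> ij js; have [ss _] := s01.
  have srt : sorted <=%R (0 :: s) by exact: (sub_sorted (fun x y => @ltW _ _ x
    y)).
  by apply: le_sorted_leq_nth => //; rewrite inE /= ltnS// (leq_trans ij).
have t01 i : (i <= size s)%N -> 0 <= t i <= 1.
  move=> his; rewrite (t_mono 0 i)//=.
  by have := t_mono i (size s) his (leqnn _);
    rewrite {2}/t (itv_partition_nth_size _ s01).
have tK i : (i <= size s)%N -> val (clamp (t i)) = t i by move=> /t01/clampK.
have btw i j k : (i <= k)%N -> (k <= j)%N -> (j <= size s)%N ->
    between (t i) (t j) (t k).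
  move=> ik kj hj; have tij : t i <= t j by apply: t_mono => //;
    exact: leq_trans kj.
  rewrite /between (min_idPl tij) (max_idPr tij) !t_mono//; exact: leq_trans hj.
pose up i := 2 * a <= w (t i.+1) - w (t i).
pose down i := 2 * a <= w (t i) - w (t i.+1).
have ltJ (P : pred nat) i : i \in seq_fset tt (seq.filter P (iota 0 (size s)))
  ->
    P i /\ (i < size s)%N.
  by rewrite seq_fsetE mem_filter mem_iota => /and3P[].
have sizeJ (P : pred nat) :
    #|` seq_fset tt (seq.filter P (iota 0 (size s)))| = count P (iota 0 (size
      s)).
  by rewrite size_seq_fset undup_id ?filter_uniq ?iota_uniq// size_filter.
have upL : (((count up (iota 0 (size s)))%:R * (a / 2))%:E <= L (a / 2))%E.
  rewrite -sizeJ; apply: (oscillations_le_length w_min lambda_length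
    (b := fun i => clamp (t i)) (c := fun i => clamp (t i.+1))) => //.
    by move=> i /ltJ[upi his]; rewrite !tK// 1?ltnW//; move: upi; rewrite /up;
      lra.
  move=> i j /ltJ[_ his] /ltJ[_ hjs] ij; rewrite !tK// 1?ltnW// 1?ltnW//.
  (* For two rises, the start of the later one lies between their ends. *)
  move: ij; rewrite neq_ltn => /orP[ij|ji].
    by right; apply: btw.
  by left; rewrite betweenC; apply: btw.
have downL : (((count down (iota 0 (size s)))%:R * (a / 2))%:E <= L (a / 2))%E.
  rewrite -sizeJ; apply: (oscillations_le_length w_min lambda_length
    (b := fun i => clamp (t i.+1)) (c := fun i => clamp (t i))) => //.
    by move=> i /ltJ[downi his]; rewrite !tK// 1?ltnW//; move: downi;
      rewrite /down; lra.
  move=> i j /ltJ[_ his] /ltJ[_ hjs] ij; rewrite !tK// 1?ltnW// 1?ltnW//.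
  (* For two falls, the end of the earlier one lies between their starts. *)
  move: ij; rewrite neq_ltn => /orP[ij|ji].
    by left; apply: btw => //; exact: ltnW.
  by right; rewrite betweenC; apply: btw => //; exact: ltnW.
have le_count : (\sum_(0 <= i < size s) (2 * a <= `|w (t i.+1) - w (t i)|)%R%:R
  : R) <=
    (count up (iota 0 (size s)))%:R + (count down (iota 0 (size s)))%:R.
  rewrite -!sum_nat_of_bool -big_split /=; apply: ler_sum => i _.
  rewrite ler_normr opprB -/(up i) -/(down i).
  by case: (up i); case: (down i) => /=; lra.
apply: (@le_trans _ _ (((count up (iota 0 (size s)))%:R * (a / 2))%:E +
   ((count down (iota 0 (size s)))%:R * (a / 2))%:E)%E).
  by rewrite -EFinD lee_fin -mulrDl ler_wpM2r// divr_ge0// ltW.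
by rewrite mule_natl mule2n leeD.
Qed.

Variables (D C r : R).
Hypotheses (D0 : 0 < D) (C0 : 0 <= C).
Hypothesis L_le : forall a, 0 < a <= D -> (L a <= (C * a `^ (- r))%:E)%E.
Hypothesis w_osc : forall s t : I, `|w (val s) - w (val t)| <= D.

Lemma p_variation_lty (p : R) : 0 < p -> r + 1 < p -> (p_variation p w < +oo)%E.
Proof.
(* Increments of size [dyadic D n.+1] are twice [dyadic D n.+2], so they are counted by the tree
   trimmed at [dyadic D n / 8]: this gives the power of [2 ^+ 3] and the division giving 8, while
   the first 2 accounts for rises and falls. *)
move=> p0 rp; pose K := 2 * (C * (2 ^+ 3) `^ r) * 8.
have K0 : 0 <= K by rewrite !mulr_ge0 ?powR_ge0.
apply: le_lt_trans (@dyadic_series_lty _ D (p - (r + 1)) K D0 _ K0); last first.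
  by rewrite subr_gt0.
apply: ge_ereal_sup => _ [s s01 <-].
pose t i := nth 1 (0 :: s) i.
pose f i n : \bar R := (dyadic D n `^ p * (dyadic D n.+1 <= `|w (t i.+1) - w (t
  i)|)%R%:R)%:E.
have f0 i n : (0 <= f i n)%E by rewrite lee_fin mulr_ge0 ?powR_ge0 ?ler0n.
have t01 i : (i <= size s)%N -> 0 <= t i <= 1.
  move=> his; rewrite /t.
  by rewrite (itv_partition_nth_ge _ s01) ?(itv_partition_nth_le _ s01).
rewrite -sumEFin; apply: (@le_trans _ _
    (\sum_(0 <= i < size s) \sum_(0 <= n <oo) f i n)%E).
  rewrite big_nat_cond [leRHS]big_nat_cond; apply: lee_sum => i /andP[/andP[_
    his] _].
  apply: powR_le_dyadic => //; rewrite normr_ge0 /=.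
  have := w_osc (clamp (t i.+1)) (clamp (t i)).
  by rewrite (clampK (t01 i.+1 his)) (clampK (t01 i (ltnW his))).
rewrite -nneseries_sum//; apply: lee_nneseries => [n _ _|n _];
  first exact: sume_ge0.
rewrite sumEFin -mulr_sumr lee_fin.
set N := \sum_(_ <= _ < _) _.
have d0 : 0 < dyadic D n by exact: dyadic_gt0.
have hN : N * (dyadic D n / 8) <= 2 * (C * (2 ^+ 3) `^ r * dyadic D n `^ (- r)).
  have [h2 h8] : dyadic D n.+1 = 2 * dyadic D n.+2 /\ dyadic D n.+2 / 2 =
    dyadic D n / 8.
    by rewrite !dyadicS; split; lra.
  have := @count_oscillations s (dyadic D n.+2) s01 (dyadic_gt0 _ D0).
  rewrite -h2 -/N h8 => /le_trans h; rewrite -lee_fin; apply: h.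
  rewrite EFinM lee_wpmul2l//.
  have := L_dyadic_le D0 C0 L_le n 3.
  by rewrite addn3 !dyadicS (_ : _ / 2 / 2 / 2 = dyadic D n / 8)//; lra.
rewrite (_ : dyadic D n `^ (p - (r + 1)) =
    dyadic D n `^ p * dyadic D n `^ (- r) / dyadic D n); last first.
  rewrite -[in RHS](powR_inv1 (ltW d0)) -!powRD; last 2 first.
  - by apply/implyP => _; rewrite gt_eqF.
  - by apply/implyP => _; rewrite gt_eqF.
  by congr (_ `^ _); lra.
rewrite -(mulrA (dyadic D n `^ p)) mulrCA ler_wpM2l ?powR_ge0// mulrA
  ler_pdivlMr//.
move: hN; rewrite /K; set X := (2 ^+ 3) `^ r; set Y := _ `^ (- r); lra.
Qed.

End variation_from_length.

(** * Comparison of the exponents *)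

Section indices.
Variables (R : realType) (w : R -> R).
Hypothesis wc : {within `[0, 1], continuous w}.
Local Notation T := (tree wc).
Local Notation I := (unit_itv R).
Hypothesis w_nonconst : exists s t : I, w (val s) <> w (val t).
Variable U : I.
Hypothesis w_min : forall t : I, w (val U) <= w (val t).
Local Notation O := (\pi_T U).
Variable lambda : {measure set (tree_borel wc) -> \bar R}.
Hypothesis lambda_length : is_length_measure O lambda.
Local Notation L a := (lambda (trimmed_tree O a)).
Local Notation N a := (trimmed_leaf_number O a).
Local Notation cov a := (covering_number wc a).

Lemma highest_point : exists2 x : T, 0 < level x - level O &
  forall y : T, level y <= level x.
Proof.
have [x [_ hx]] := highest_above O.
have {}hx (y : T) : level y <= level x by apply: hx; exact: below_root.
exists x => //; rewrite subr_gt0; have [//|xO] := ltP (level O) (level x).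
have [s [t st]] := w_nonconst; exfalso; apply: st.
have e (u : I) : w (val u) = level O.
  apply/eqP; rewrite eq_le -(level_pi wc u) (level_root w_min) andbT.
  exact: le_trans (hx _) xO.
by rewrite !e.
Qed.

Lemma growth_exponent_mono (f g : R -> \bar R) :
  (forall a, 0 < a -> (f a <= g a)%E) ->
  (growth_exponent f <= growth_exponent g)%E.
Proof.
move=> fg; apply: lee_ltEFin => r /growth_exponent_lt[d d0 gr].
apply: (@growth_exponent_le _ _ _ 1 d) => // a /andP[a0 ad].
by rewrite mul1r (le_trans (fg _ a0))// gr// a0.
Qed.

(** The arc to the highest point keeps half its length in the trimmed tree for small [a]. *)
Lemma growth_length_ge0 : (0 <= growth_exponent (fun a => L a))%E.
Proof.
have [x D0 _] := highest_point; set D := _ - _ in D0.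
apply: (@growth_exponent_ge _ _ 0 (D / 2) (D / 2)); rewrite ?divr_gt0// => a.
move=> /andP[a0 aD]; rewrite oppr0 powRr0 mulr1.
apply: le_trans (lambda_trimmed_ge w_min lambda_length x (ltW a0)).
by rewrite lee_fin -/D; lra.
Qed.

Lemma growth_length_le_leaves : (growth_exponent (fun a => L a) + 1 <=
  maxe (growth_exponent (trimmed_leaf_number O)) 1)%E.
Proof.
have [x D0 xmax] := highest_point; set D := _ - _ in D0.
apply: lee_ltEFin => r; rewrite gt_max lte_fin => /andP[+ r1].
move=> /growth_exponent_lt[d d0 Nr].
pose e := d / 2; have e0 : 0 < e by rewrite divr_gt0.
(* Beyond the total height [D] the trimmed tree is empty, so one comparison from such a [b] down to
   [e] shows that [L e] is finite. *)
have [M M0 LM] : exists2 M : R, 0 <= M & (L e <= M%:E)%E.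
  pose b := D + e + 1.
  have eb : e < b by rewrite /b; lra.
  have Lb : L b = 0%E.
    rewrite (_ : trimmed_tree O b = set0) ?measure0//.
    apply/seteqP; split=> // y; rewrite /trimmed_tree /=.
    have [z _ ->] := height_attained w_min y.
    by have := xmax z; have := level_root w_min y; rewrite /b /D in e0 *; lra.
  exists ((b - e) * e `^ (- r)); first by rewrite mulr_ge0 ?powR_ge0// subr_ge0
    ltW.
  apply: (le_trans (lambda_trimmed_leaves w_min lambda_length e0 eb)).
  rewrite Lb add0e EFinM; apply: lee_wpmul2l;
    first by rewrite lee_fin subr_ge0 ltW.
  by apply: Nr; rewrite e0 /e; lra.
have q1 : 2 `^ (1 - r) < 1.
  have e2 : 1 `^ (r - 1) = 1 :> R by rewrite powR1.
  rewrite -opprB powRN invf_lt1 ?powR_gt0// -[ltLHS]e2.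
  by apply: gt0_ltr_powR; rewrite ?nnegrE ?subr_gt0// ltr1n.
pose C := Num.max (M * d `^ (r - 1)) (1 - 2 `^ (1 - r))^-1.
have C0 : 0 < C by rewrite lt_max orbC invr_gt0 subr_gt0 q1.
have base a : e <= a < d -> (L a <= (C * a `^ (1 - r))%:E)%E.
  move=> /andP[ea ad]; apply: (le_trans (le_lambda_trimmed w_min lambda ea)).
  apply: (le_trans LM); rewrite lee_fin.
  have a0 : 0 < a by exact: lt_le_trans ea.
  have e1 : 1 - r = - (r - 1) by lra.
  rewrite e1 powRN ler_pdivlMr ?powR_gt0//.
  apply: (@le_trans _ _ (M * d `^ (r - 1))); last by rewrite le_max lexx.
  rewrite ler_wpM2l//; apply: ge0_ler_powR; rewrite ?nnegrE ?(ltW a0) ?(ltW d0)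
    ?(ltW ad)//.
  by rewrite subr_ge0 ltW.
have main n a : dyadic e n <= a < d -> (L a <= (C * a `^ (1 - r))%:E)%E.
  elim: n a => [|n ih] a; first by rewrite /dyadic expr0 divr1; exact: base.
  move=> /andP[na ad]; have [ea|ae] := leP e a; first by apply: base;
    rewrite ea.
  have a0 : 0 < a by apply: lt_le_trans na; exact: dyadic_gt0.
  have a2 : a < 2 * a by lra.
  apply: (le_trans (lambda_trimmed_leaves w_min lambda_length a0 a2)).
  have h2a : (L (2 * a) <= (C * (2 * a) `^ (1 - r))%:E)%E.
    by apply: ih; move: na; rewrite dyadicS /e in ae *; lra.
  have hN : ((2 * a - a)%:E * N a <= (a * a `^ (- r))%:E)%E.
    rewrite (_ : 2 * a - a = a); last lra.
    rewrite EFinM lee_wpmul2l ?lee_fin ?(ltW a0)//.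
    by apply: Nr; rewrite a0.
  apply: (le_trans (leeD h2a hN)).
  rewrite -EFinD lee_fin powRM ?(ltW a0)//.
  have -> : a * a `^ (- r) = a `^ (1 - r).
    by rewrite -{1}[a]powRr1 ?(ltW a0)// -powRD//; apply/implyP => _;
      rewrite gt_eqF.
  have hC : 1 <= C * (1 - 2 `^ (1 - r)).
    by rewrite -ler_pdivrMr ?subr_gt0// div1r le_max lexx orbT.
  have := powR_ge0 a (1 - r); move: hC; set X := a `^ _; set q := 2 `^ _.
  move=> hC X0; have := ler_wpM2r X0 hC; lra.
have : (growth_exponent (fun a => L a) <= (r - 1)%:E)%E.
  apply: (@growth_exponent_le _ _ _ C d) => // a /andP[a0 ad].
  rewrite opprB; have [n na] := dyadic_small e0 a0.
  by apply: (main n); rewrite na.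
by rewrite EFinB leeBrDr.
Qed.

Lemma growth_leaves_le_dim :
  (maxe (growth_exponent (trimmed_leaf_number O)) 1 <= upper_box_dim wc)%E.
Proof.
rewrite ge_max; apply/andP; split.
  by apply: growth_exponent_mono => a a0; exact: trimmed_leaf_le_covering.
have [x D0 _] := highest_point; set D := _ - _ in D0.
apply: (@growth_exponent_ge _ _ 1 (D / 2) 1);
  rewrite ?divr_gt0// => a /andP[a0 _].
rewrite powR_inv1 ?(ltW a0)//.
(* The covering number is at least of order [1 / a]: the arc to the highest point carries [n.+1]
   points with levels [2 * a] apart. *)
pose n := Num.truncn (D / 2 / a).
have Da0 : 0 <= D / 2 / a by rewrite !divr_ge0// ltW.
have : forall i, exists y : T, (i <= n)%N -> level y = level O + 2 * a * i%:R.
  move=> i; have [il|_] := boolP (i <= n)%N; last by exists O.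
  have [|y [_ hy]] := @below_exists _ _ wc U x (level O + 2 * a * i%:R).
    rewrite lerDl !mulr_ge0 ?(ltW a0)//=.
    have : i%:R <= D / 2 / a.
      apply: le_trans (_ : n%:R <= _); first by rewrite ler_nat.
      by rewrite truncn_le.
    rewrite ler_pdivlMr// => h; rewrite /D in h; lra.
  by exists y.
move=> /choice[y hy].
have sep : forall i j, `I_n.+1 i -> `I_n.+1 j -> i <> j ->
  2 * a <= mdist (y i) (y j).
  move=> i j /= hi hj /eqP ij; apply: le_trans (level_dist _ _).
  rewrite !hy//; have a20 : 0 <= 2 * a by rewrite mulr_ge0// ltW.
  have gap k l : (k < l)%N -> 2 * a <= 2 * a * (l%:R - k%:R).
    by rewrite -(ler_nat R) -natr1 => kl; rewrite ler_peMr//; lra.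
  move: ij; rewrite neq_ltn => /orP[/gap|/gap] h.
    by rewrite distrC; apply: le_trans (ler_norm _); lra.
  by apply: le_trans (ler_norm _); lra.
apply: le_trans (packing_le_covering sep).
rewrite /counting asboolT; last exact: finite_II.
rewrite (card_fset_set (card_eqxx _)) lee_fin ltW//.
exact: truncnS_gt.
Qed.

Lemma dim_le_variation_index : (upper_box_dim wc <= variation_index w)%E.
Proof.
apply: le_ereal_inf_tmp => _ [p [p1 Vp] <-].
have := fun a a0 => @covering_le_variation _ _ wc p a a0 p1 Vp.
set V := fine _ => hV.
have V0 : 0 <= V by apply: fine_ge0; exact: p_variation_ge0.
have C0 : 0 < 1 + V * 3 `^ p by rewrite ltr_pwDl ?mulr_ge0 ?powR_ge0.
apply: (@growth_exponent_le _ _ _ _ 1 C0) => // a /andP[a0 a1].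
apply: (le_trans (hV _ a0)); rewrite lee_fin powRN.
have ap0 : 0 < a `^ p by rewrite powR_gt0.
have -> : (a / 3) `^ p = a `^ p / 3 `^ p.
  rewrite powRM ?invr_ge0 ?(ltW a0)//; congr (_ * _).
  by rewrite -(@powR_inv1 _ 3)// -powRrM mulN1r powRN.
rewrite invfM invrK mulrA mulrDl mul1r mulrAC lerD2r.
have e1 : 1 `^ p = 1 :> R by rewrite powR1.
rewrite invf_ge1// -[leRHS]e1; apply: ge0_ler_powR;
  rewrite ?nnegrE ?(ltW a0) ?(ltW a1)//.
exact: le_trans p1.
Qed.

(** The dyadic sums start at scale [D], so the bound for small [a] is extended up to [D]: for larger
    [a], compare with [L (d / 2)] by monotonicity. *)
Lemma length_bound (r : R) : 0 <= r ->
  (growth_exponent (fun a => L a) < r%:E)%E ->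
  forall D : R, 0 < D -> exists2 C, 0 <= C &
    forall a, 0 < a <= D -> (L a <= (C * a `^ (- r))%:E)%E.
Proof.
move=> r0 /growth_exponent_lt[d d0 hL] D D0.
have d20 : 0 < d / 2 by rewrite divr_gt0.
exists (1 + (d / 2) `^ (- r) * D `^ r).
  by rewrite addr_ge0 ?mulr_ge0 ?powR_ge0.
move=> a /andP[a0 aD]; have [ad|da] := ltP a d.
  apply: le_trans (hL _ _) _; first by rewrite a0.
  by rewrite lee_fin ler_peMl ?powR_ge0// lerDl mulr_ge0 ?powR_ge0.
have da2 : d / 2 <= a by lra.
apply: (le_trans (le_lambda_trimmed w_min lambda da2)).
apply: le_trans (hL _ _) _; first by rewrite d20; lra.
rewrite lee_fin (powRN a) ler_pdivlMr ?powR_gt0//.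
apply: (@le_trans _ _ ((d / 2) `^ (- r) * D `^ r)); last by rewrite lerDr.
by rewrite ler_wpM2l ?powR_ge0// ge0_ler_powR ?nnegrE// ltW.
Qed.

Lemma between_growth_length (r : R) :
  (growth_exponent (fun a => L a) + 1 < r%:E)%E ->
  exists r', [/\ 0 <= r', r' + 1 < r &
    (growth_exponent (fun a => L a) < r'%:E)%E].
Proof.
have := growth_length_ge0; case: (growth_exponent _) => [g||]//.
rewrite lee_fin -EFinD lte_fin => g0 gr; exists ((g + (r - 1)) / 2).
by rewrite lte_fin; split; lra.
Qed.

Lemma variation_index_le_length :
  (variation_index w <= growth_exponent (fun a => L a) + 1)%E.
Proof.
apply: lee_ltEFin => r /between_growth_length[r' [r'0 r'r gr']].
have [r1 r0 r'r1] : [/\ 1 <= r, 0 < r & r' < r - 1] by split; lra.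
have [x D0 xmax] := highest_point; set D := _ - _ in D0.
have [C C0 hC] := length_bound r'0 gr' D0.
apply: ereal_inf_lbound; exists r => //; split=> //.
apply: (p_variation_lty w_min lambda_length D0 C0 hC) => //.
move: xmax; rewrite /D; clear -w_min => xmax s t;
  rewrite -!(level_pi wc) ler_norml.
have := xmax (\pi_T s); have := xmax (\pi_T t).
have := level_root w_min (\pi_T s); have := level_root w_min (\pi_T t).
by move: (level _) (level _) (level _) (level _); clear; move=> *; apply/andP;
  split; lra.
Qed.

Lemma height_index_le_length :
  (height_index O lambda <= growth_exponent (fun a => L a) + 1)%E.
Proof.
apply: lee_ltEFin => r /between_growth_length[r' [r'0 r'r gr']].
have [r1 r0 r'r1] : [/\ 1 <= r, 0 < r & r' < r - 1] by split; lra.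
have [x D0 xmax] := highest_point; set D := _ - _ in D0.
have [C C0 hC] := length_bound r'0 gr' D0.
apply: ereal_inf_lbound; exists r => //; split=> //.
apply: (height_integral_lty w_min D0 C0 r'0 hC) => //.
move: xmax; rewrite /D; clear -w_min => xmax y;
  have [z _ ->] := height_attained w_min y.
have := xmax z; have := level_root w_min y.
by move: (level _) (level _) (level _) (level _); clear; move=> *; lra.
Qed.

Lemma length_le_height_index :
  (growth_exponent (fun a => L a) + 1 <= height_index O lambda)%E.
Proof.
apply: le_ereal_inf_tmp => _ [p [p1 hp] <-].
set J := (\int[lambda]_x _)%E in hp.
have J0 : (0 <= J)%E by apply: integral_ge0 => x _; rewrite lee_fin powR_ge0.
have Jfin : J \is a fin_num by rewrite ge0_fin_numE.
have p10 : 0 <= p - 1 by rewrite subr_ge0.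
suff : (growth_exponent (fun a => L a) <= (p - 1)%:E)%E by rewrite EFinB
  leeBrDr.
(* Adding one keeps the constant positive even if the integral vanishes. *)
apply: (@growth_exponent_le _ _ _ (fine J + 1) 1) => //.
  by rewrite ltr_wpDl// fine_ge0.
move=> a /andP[a0 _]; rewrite powRN EFinM -lee_pdivrMr; last first.
  by rewrite invr_gt0 powR_gt0.
rewrite invrK muleC; apply: (le_trans (markov_height w_min lambda p10 a0)).
by rewrite -/J -(fineK Jfin) lee_fin lerDl.
Qed.

End indices.

Theorem theorem3p1 (R : realType) (w : R -> R)
  (wc : {within `[0, 1], continuous w})
  (w_nonconst : exists s t : unit_itv R, w (val s) <> w (val t))
  (U : unit_itv R) (w_min : forall t : unit_itv R, w (val U) <= w (val t))
  (O : tree wc) (OE : O = \pi_(tree wc) U)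
  (lambda : {measure set (tree_borel wc) -> \bar R})
  (lambda_length : is_length_measure O lambda) :
  [/\ variation_index w = height_index O lambda,
      height_index O lambda =
        (growth_exponent (fun a => lambda (trimmed_tree O a)) + 1)%E,
      (growth_exponent (fun a => lambda (trimmed_tree O a)) + 1)%E =
        maxe (growth_exponent (trimmed_leaf_number O)) 1%E &
      maxe (growth_exponent (trimmed_leaf_number O)) 1%E = upper_box_dim wc].
Proof.
subst O.
have LN := growth_length_le_leaves w_nonconst w_min lambda_length.
have ND := growth_leaves_le_dim wc w_nonconst w_min.
have DV := dim_le_variation_index wc.
have VL := variation_index_le_length w_nonconst w_min lambda_length.
have HL := height_index_le_length w_nonconst w_min lambda_length.
have LH := length_le_height_index w_min lambda.
have HE := @le_anti _ _ _ _ (introT andP (conj HL LH)).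
(* The inequalities [VL], [LN], [ND] and [DV] form a cycle; each equality combines some of them in
   both directions. *)
rewrite HE; split => //; apply: le_anti; apply/andP; split.
- exact: VL.
- exact: le_trans LN (le_trans ND DV).
- exact: LN.
- exact: le_trans ND (le_trans DV VL).
- exact: ND.
- exact: le_trans DV (le_trans VL LN).
Qed.
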